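(* Let $(A,\cdot,\delta,D,Q)$ be a commutative and cocommutative differential antisymmetric infinitesimal (ASI) bialgebra and $L=A\otimes\mathbf{k}[t,t^{-1}]$, with $at^m:=a\otimes t^m$. For $q\in\mathbf{k}$ define a binary operation on $L$ by $$[at^m,bt^n]_q=m\big(a\cdot(D+qQ)(b)\big)t^{m+n-1}-n\big(b\cdot(D+qQ)(a)\big)t^{m+n-1},\qquad a,b\in A,\ m,n\in\mathbb{Z},$$ and a linear map $\delta_{L,q}:L\to L\,\widehat{\otimes}\,L$ by $$\delta_{L,q}(at^m)=\sum_{i\in\mathbb{Z}}\sum(i+1)\Big(a_{(1)}t^{-i-2}\otimes (Q+qD)(a_{(2)})t^{m+i}-(Q+qD)(a_{(2)})t^{m+i}\otimes a_{(1)}t^{-i-2}\Big),\qquad a\in A,\ m\in\mathbb{Z},$$ where $\delta(a)=\sum a_{(1)}\otimes a_{(2)}$. Then: (a) $(L,[\cdot,\cdot]_{-\frac12},\delta_{L,-\frac12})$ is a completed Lie bialgebra. (b) If $a\cdot Q(b)=-a\cdot D(b)$ for all $a,b\in A$ and $(\mathrm{id}\otimes Q)\delta=-(\mathrm{id}\otimes D)\delta$, then $(L,[\cdot,\cdot]_q,\delta_{L,q})$ is a completed Lie bialgebra for any $q\in\mathbf{k}$.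
   Context: $\mathbf{k}$ is a field of characteristic $0$; $A$ is a finite-dimensional $\mathbf{k}$-vector space. $\tau(a\otimes b)=b\otimes a$. For a binary operation $*$, $L_*(a)b=a*b$ and $R_*(a)b=b*a$. Admissible commutative differential algebra $(A,\cdot,D,Q)$: $(A,\cdot)$ is a commutative associative algebra, $D,Q:A\to A$ are linear, $D(a\cdot b)=D(a)\cdot b+a\cdot D(b)$ and $Q(a\cdot b)=Q(a)\cdot b-a\cdot D(b)$. Admissible cocommutative differential coalgebra $(A,\delta,Q,D)$: $\delta:A\to A\otimes A$ is linear with $(\delta\otimes\mathrm{id})\delta=(\mathrm{id}\otimes\delta)\delta$, $\delta=\tau\delta$, $\delta Q=(\mathrm{id}\otimes Q+Q\otimes\mathrm{id})\delta$, and $\delta D=(D\otimes\mathrm{id}-\mathrm{id}\otimes Q)\delta$. ASI bialgebra $(A,\cdot,\delta)$: $(A,\cdot)$ associative, $(A,\delta)$ coassociative, and $\delta(a\cdot b)=(\mathrm{id}\otimes L_\cdot(a))\delta(b)+(R_\cdot(b)\otimes\mathrm{id})\delta(a)$ and $(L_\cdot(b)\otimes\mathrm{id}-\mathrm{id}\otimes R_\cdot(b))\delta(a)+\tau\big((L_\cdot(a)\otimes\mathrm{id}-\mathrm{id}\otimes R_\cdot(a))\delta(b)\big)=0$ for all $a,b$. A commutative and cocommutative differential ASI bialgebra is $(A,\cdot,\delta,D,Q)$ such that $(A,\cdot,\delta)$ is an ASI bialgebra, $(A,\cdot,D,Q)$ is an admissible commutative differential algebra, and $(A,\delta,Q,D)$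 is an admissible cocommutative differential coalgebra. Completed tensor products: for $\mathbb{Z}$-graded vector spaces $C=\bigoplus_i C_i$, $E=\bigoplus_j E_j$ with finite-dimensional components, $C\,\widehat{\otimes}\,E:=\prod_{i,j\in\mathbb{Z}}C_i\otimes E_j$; its elements are possibly infinite sums $\sum_{i,j,\alpha}c_{i\alpha}\otimes e_{j\alpha}$ ($\alpha$ in a finite index set depending on $i,j$). For linear maps $f,g$ set $(f\,\widehat{\otimes}\,g)(\sum c_{i\alpha}\otimes e_{j\alpha})=\sum f(c_{i\alpha})\otimes g(e_{j\alpha})$, and $\widehat{\tau}(\sum c_{i\alpha}\otimes e_{j\alpha})=\sum e_{j\alpha}\otimes c_{i\alpha}$ (similarly for triple completed tensor products). $L=A\otimes\mathbf{k}[t,t^{-1}]$ is graded with components $A\otimes t^i$. Completed Lie coalgebra $(L,\delta)$: $L=\bigoplus_{i\in\mathbb{Z}}L_i$ graded with all $L_i$ finite-dimensional, $\delta:L\to L\,\widehat{\otimes}\,L$ linear with $\delta(a)=-\widehat{\tau}\delta(a)$ and $(\mathrm{id}\,\widehat{\otimes}\,\delta)\delta(a)-(\widehat{\tau}\,\widehat{\otimes}\,\mathrm{id})(\mathrm{id}\,\widehat{\otimes}\,\delta)\delta(a)=(\delta\,\widehat{\otimes}\,\mathrm{id})\delta(a)$ for all $a\in L$. Completed Lie bialgebra $(L,[\cdot,\cdot],\delta)$: $(L,[\cdot,\cdot])$ is a Lie algebra, $(L,\delta)$ is a completed Lie coalgebra, and $\delta([a,b])=(\mathrm{ad}_a\,\widehat{\otimes}\,\mathrm{id}+\mathrm{id}\,\widehat{\otimes}\,\mathrm{ad}_a)\delta(b)-(\mathrm{ad}_b\,\widehat{\otimes}\,\mathrm{id}+\mathrm{id}\,\widehat{\otimes}\,\mathrm{ad}_b)\delta(a)$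 for all $a,b\in L$, where $\mathrm{ad}_a(b)=[a,b]$. *)

(* Defs.v *)
From HB Require Import structures.
From mathcomp Require Import all_boot all_order all_algebra.
From mathcomp Require Import boolp classical_sets functions cardinality fsbigop.

Set Implicit Arguments.
Unset Strict Implicit.
Unset Printing Implicit Defensive.

Import GRing.Theory VectorInternalTheory.
Local Open Scope ring_scope.

Notation is_bilinear f := (bilinear_for *:%R *:%R f).

(* Tensor product of finite-dimensional spaces, in coordinates.  [tens_bilinear],
   [tlift_tens] and [tens_ext] are its universal property; the maps below are
   all given by their values on pure tensors. *)
Section Tensor.
Variable k : fieldType.

Definition tensor (U V : vectType k) : vectType k := 'M[k]_(dim U, dim V).

Definition tens (U V : vectType k) (u : U) (v : V) : tensor U V :=
  (v2r u)^T *m v2r v.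

(* The linear map with u (x) v |-> f u v; only meaningful for bilinear f. *)
Definition tlift (U V : vectType k) (W : lmodType k) (f : U -> V -> W)
    (x : tensor U V) : W :=
  \sum_i \sum_j (x : 'M[k]_(dim U, dim V)) i j *:
    f (r2v (delta_mx 0 i)) (r2v (delta_mx 0 j)).

Lemma tens_bilinear (U V : vectType k) : is_bilinear (@tens U V).
Proof.
split=> [v c x y|u c x y]; rewrite /tens linearP /=.
  by rewrite linearP /= mulmxDl scalemxAl.
by rewrite mulmxDr scalemxAr.
Qed.

Lemma tlift_linear (U V : vectType k) (W : lmodType k) (f : U -> V -> W) :
  linear (tlift f).
Proof.
move=> c x y; rewrite /tlift scaler_sumr -big_split; apply: eq_bigr => i _ /=.
rewrite scaler_sumr -big_split; apply: eq_bigr => j _ /=.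
by rewrite !mxE scalerDl scalerA.
Qed.

Lemma v2r_decomp (U : vectType k) (u : U) :
  u = \sum_i v2r u 0 i *: r2v (delta_mx 0 i).
Proof.
rewrite -[LHS]v2rK [in LHS](row_sum_delta (v2r u)) linear_sum /=.
by apply: eq_bigr => i _; rewrite linearZ.
Qed.

Lemma linear_sumZ (U W : lmodType k) (f : U -> W) n (c : 'I_n -> k)
    (e : 'I_n -> U) :
  linear f -> f (\sum_i c i *: e i) = \sum_i c i *: f (e i).
Proof.
move=> fl; pose F : {linear U -> W} := HB.pack f (GRing.isLinear.Build _ _ _ _ f fl).
by rewrite -[f]/(F : U -> W) linear_sum; apply: eq_bigr => i _; rewrite linearZ.
Qed.

Lemma tlift_tens (U V : vectType k) (W : lmodType k) (f : U -> V -> W) u v :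
  is_bilinear f -> tlift f (tens u v) = f u v.
Proof.
move=> [fl fr]; rewrite {2}(v2r_decomp u).
rewrite (linear_sumZ (f := f^~ v) _ _ (fl v)); apply: eq_bigr => i _.
rewrite {2}(v2r_decomp v) (linear_sumZ _ _ (fr _)) scaler_sumr.
by apply: eq_bigr => j _; rewrite !mxE big_ord1 !mxE scalerA.
Qed.

Lemma tens_ext (U V : vectType k) (W : lmodType k) (h1 h2 : tensor U V -> W) :
  linear h1 -> linear h2 -> (forall u v, h1 (tens u v) = h2 (tens u v)) ->
  h1 =1 h2.
Proof.
move=> l1 l2 h12 x.
have lift (h : tensor U V -> W) : linear h -> h x = tlift (fun u v => h (tens u v)) x.
  move=> hl; pose H : {linear tensor U V -> W} :=
    HB.pack h (GRing.isLinear.Build _ _ _ _ h hl).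
  rewrite -[LHS]/(H x) [in LHS](matrix_sum_delta x) linear_sum /=.
  apply: eq_bigr => i _; rewrite -[LHS]/(H _) linear_sum /=.
  apply: eq_bigr => j _; rewrite -[LHS]/(H _) linearZ /= /tens !r2vK.
  by rewrite trmx_delta mul_delta_mx.
by rewrite (lift h1) // (lift h2) //; do 2!apply: eq_bigr => ? _; rewrite h12.
Qed.

Definition tmap (U V U' V' : vectType k) (f : U -> U') (g : V -> V') :
    tensor U V -> tensor U' V' :=
  tlift (fun u v => tens (f u) (g v)).

Definition tswap (U V : vectType k) : tensor U V -> tensor V U :=
  tlift (fun u v => tens v u).

Definition tassoc (U V W : vectType k) :
    tensor (tensor U V) W -> tensor U (tensor V W) :=
  tlift (fun x w => tlift (fun u v => tens u (tens v w)) x).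

(* tau (x) id, on right-bracketed triple tensors *)
Definition tswap12 (U V W : vectType k) :
    tensor U (tensor V W) -> tensor V (tensor U W) :=
  tlift (fun u y => tlift (fun v w => tens v (tens u w)) y).

End Tensor.
Arguments tens {k U V} u v.
Arguments tlift {k U V W} f x.
Arguments tmap {k U V U' V'} f g x.
Arguments tswap {k U V} x.
Arguments tassoc {k U V W} x.
Arguments tswap12 {k U V W} x.

Section FiniteDimensional.
Variables (k : fieldType) (A : vectType k).
Implicit Types (mul : A -> A -> A) (delta : A -> tensor A A) (D Q : A -> A).

Record is_assoc_algebra mul : Prop := {
  assoc_bilinear : is_bilinear mul;
  assoc_mulA : associative mul }.

Record is_coassoc_coalgebra delta : Prop := {
  coassoc_linear : linear delta;
  coassoc_coA : forall a,
    tassoc (tmap delta id (delta a)) = tmap id delta (delta a) }.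

Record is_adm_comm_diff_algebra mul D Q : Prop := {
  adm_assoc : is_assoc_algebra mul;
  adm_comm : commutative mul;
  adm_D_linear : linear D;
  adm_Q_linear : linear Q;
  adm_D : forall a b, D (mul a b) = mul (D a) b + mul a (D b);
  adm_Q : forall a b, Q (mul a b) = mul (Q a) b - mul a (D b) }.

Record is_adm_cocomm_diff_coalgebra delta Q D : Prop := {
  coadm_coassoc : is_coassoc_coalgebra delta;
  coadm_cocomm : forall a, delta a = tswap (delta a);
  coadm_Q_linear : linear Q;
  coadm_D_linear : linear D;
  coadm_Q : forall a,
    delta (Q a) = tmap id Q (delta a) + tmap Q id (delta a);
  coadm_D : forall a,
    delta (D a) = tmap D id (delta a) - tmap id Q (delta a) }.

Record is_ASI_bialgebra mul delta : Prop := {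
  asi_assoc : is_assoc_algebra mul;
  asi_coassoc : is_coassoc_coalgebra delta;
  asi_mul : forall a b,
    delta (mul a b) = tmap id (mul a) (delta b) + tmap (mul^~ b) id (delta a);
  asi_antisym : forall a b,
    (tmap (mul b) id (delta a) - tmap id (mul^~ b) (delta a))
    + tswap (tmap (mul a) id (delta b) - tmap id (mul^~ a) (delta b)) = 0 }.

Record is_cc_diff_ASI_bialgebra mul delta D Q : Prop := {
  cc_asi : is_ASI_bialgebra mul delta;
  cc_algebra : is_adm_comm_diff_algebra mul D Q;
  cc_coalgebra : is_adm_cocomm_diff_coalgebra delta Q D }.

End FiniteDimensional.

Section Families.
Variables (k : fieldType) (I : choiceType) (V : I -> vectType k).

Definition cprod := forall i, V i.

HB.instance Definition _ := gen_eqMixin cprod.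
HB.instance Definition _ := gen_choiceMixin cprod.

Let cp0 : cprod := fun=> 0.
Let cpN (x : cprod) : cprod := fun i => - x i.
Let cpD (x y : cprod) : cprod := fun i => x i + y i.
Let cpZ (c : k) (x : cprod) : cprod := fun i => c *: x i.

Fact cprod_addA : associative cpD.
Proof. by move=> x y z; apply: functional_extensionality_dep => i; apply: addrA. Qed.
Fact cprod_addC : commutative cpD.
Proof. by move=> x y; apply: functional_extensionality_dep => i; apply: addrC. Qed.
Fact cprod_add0 : left_id cp0 cpD.
Proof. by move=> x; apply: functional_extensionality_dep => i; apply: add0r. Qed.
Fact cprod_addN : left_inverse cp0 cpN cpD.
Proof. by move=> x; apply: functional_extensionality_dep => i; apply: addNr. Qed.
HB.instance Definition _ :=
  GRing.isZmodule.Build cprod cprod_addA cprod_addC cprod_add0 cprod_addN.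

Fact cprod_scaleA a b x : cpZ a (cpZ b x) = cpZ (a * b) x.
Proof. by apply: functional_extensionality_dep => i; apply: scalerA. Qed.
Fact cprod_scale1 : left_id 1 cpZ.
Proof. by move=> x; apply: functional_extensionality_dep => i; apply: scale1r. Qed.
Fact cprod_scaleDr : right_distributive cpZ +%R.
Proof. by move=> c x y; apply: functional_extensionality_dep => i; apply: scalerDr. Qed.
Fact cprod_scaleDl x : {morph cpZ^~ x : a b / a + b}.
Proof. by move=> a b; apply: functional_extensionality_dep => i; apply: scalerDl. Qed.
HB.instance Definition _ := GRing.Zmodule_isLmodule.Build k cprod
  cprod_scaleA cprod_scale1 cprod_scaleDr cprod_scaleDl.

Lemma cprodDE (x y : cprod) i : (x + y) i = x i + y i. Proof. by []. Qed.
Lemma cprodZE c (x : cprod) i : (c *: x) i = c *: x i. Proof. by []. Qed.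

Definition finitely_supported : {pred cprod} :=
  fun x => `[< finite_set [set i | x i != 0]%classic >].

Fact finitely_supported_submod : submod_closed finitely_supported.
Proof.
split.
  apply/asboolP; rewrite (_ : [set _ | _]%classic = set0); first exact: finite_set0.
  by apply/seteqP; split=> // i /=; rewrite eqxx.
move=> c x y /asboolP fx /asboolP fy; apply/asboolP.
apply: (@sub_finite_set _ _ ([set i | x i != 0] `|` [set i | y i != 0])%classic).
  move=> i /=; rewrite cprodDE cprodZE.
  have [->|? _] := eqVneq (x i) 0; last by left.
  have [->|? _] := eqVneq (y i) 0; last by right.
  by rewrite scaler0 addr0 eqxx.
by rewrite finite_setU.
Qed.
HB.instance Definition _ :=
  GRing.isSubmodClosed.Build k cprod finitely_supported finitely_supported_submod.

Record dsum := DSum {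
  dsum_val : cprod; dsum_valP : dsum_val \in finitely_supported }.

Definition dsum_fun (x : dsum) : forall i, V i := dsum_val x.
Coercion dsum_fun : dsum >-> Funclass.

HB.instance Definition _ := [isSub for dsum_val].
HB.instance Definition _ := [Choice of dsum by <:].
HB.instance Definition _ := [SubChoice_isSubLmodule of dsum by <:].

End Families.

Section DirectSum.
Variables (k : fieldType) (I : choiceType) (V : I -> vectType k).

Fact dinj_subproof i (v : V i) :
  (dfwith (fun=> 0) v : cprod V) \in @finitely_supported k I V.
Proof.
apply/asboolP; apply: (@sub_finite_set _ _ [set i]%classic _ (finite_set1 i)).
move=> j /=; have [<- //|ij] := eqVneq i j.
by rewrite dfwith_out // eqxx.
Qed.

Definition dinj i (v : V i) : dsum V := DSum (dinj_subproof v).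

(* The linear map on the direct sum whose restriction to V i is f i; only
   meaningful when every f i is linear. *)
Definition dlift (W : lmodType k) (f : forall i, V i -> W) (x : dsum V) : W :=
  \sum_(i \in [set: I]) f i (x i).

Lemma dlift_dinj (W : lmodType k) (f : forall i, V i -> W) i (v : V i) :
  (forall j, f j 0 = 0) -> dlift f (dinj v) = f i v.
Proof.
move=> f0; rewrite /dlift -(fsbig_widen [set i]%classic) //.
  by rewrite fsbig_set1 /dsum_fun /= dfwith_in.
move=> j /= [_ /eqP ij]; rewrite /dsum_fun /= dfwith_out; first exact: f0.
by rewrite eq_sym.
Qed.

End DirectSum.
Arguments dinj {k I} V i v.
Arguments dlift {k I V W} f x.

(* Completed tensor products.  If L and M are the direct sums of V and W, then
   their completed tensor product is [cprod (ftens V W)]. *)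
Section CompletedTensor.
Variable k : fieldType.

Definition ftens (I J : choiceType) (V : I -> vectType k) (W : J -> vectType k)
    : I * J -> vectType k :=
  fun p => tensor (V p.1) (W p.2).

Definition ctens (I J : choiceType) (V : I -> vectType k) (W : J -> vectType k)
    (x : dsum V) (y : dsum W) : cprod (ftens V W) :=
  fun p => tens (x p.1) (y p.2).

Section Maps.
Variables (I J I' J' : choiceType).
Variables (V : I -> vectType k) (W : J -> vectType k).
Variables (V' : I' -> vectType k) (W' : J' -> vectType k).
Variables (f : dsum V -> cprod V') (g : dsum W -> cprod W').

(* contribution of the component p of x to the component r of the image of x *)
Definition ctmap_term (x : cprod (ftens V W)) (r : I' * J') (p : I * J) :
    ftens V' W' r :=
  tmap (fun v => f (dinj V p.1 v) r.1) (fun w => g (dinj W p.2 w) r.2) (x p).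

(* The possibly infinite sum defining [ctmap x] makes sense. *)
Definition ctmap_summable (x : cprod (ftens V W)) : Prop :=
  forall r, finite_set [set p | ctmap_term x r p != 0]%classic.

(* Junk value 0 in the components where the sum has infinite support. *)
Definition ctmap (x : cprod (ftens V W)) : cprod (ftens V' W') :=
  fun r => \sum_(p \in [set: I * J]) ctmap_term x r p.
End Maps.

Variables (I : choiceType) (V : I -> vectType k).

Definition cswap (x : cprod (ftens V V)) : cprod (ftens V V) :=
  fun p => tswap (x (p.2, p.1)).

Definition cswap12 (x : cprod (ftens V (ftens V V))) :
    cprod (ftens V (ftens V V)) :=
  fun p => tswap12 (x (p.2.1, (p.1, p.2.2))).

Definition cassoc (x : cprod (ftens (ftens V V) V)) :
    cprod (ftens V (ftens V V)) :=
  fun p => tassoc (x ((p.1, p.2.1), p.2.2)).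

Definition csum (T : choiceType) (F : T -> cprod V) : cprod V :=
  fun i => \sum_(t \in [set: T]) F t i.

End CompletedTensor.

Record is_lie_algebra (k : fieldType) (L : lmodType k) (br : L -> L -> L)
    : Prop := {
  lie_bilinear : is_bilinear br;
  lie_alternating : forall x, br x x = 0;
  lie_jacobi : forall x y z,
    br x (br y z) + br y (br z x) + br z (br x y) = 0 }.

Section CompletedLie.
Variables (k : fieldType) (V : int -> vectType k).
Local Notation L := (dsum V).
Local Notation idL := (@dsum_val k int V).

Definition ad (br : L -> L -> L) (a : L) : L -> cprod V :=
  fun b => dsum_val (br a b).

(* The summability clauses say that the completed tensor products of maps
   occurring in the identities are defined at the given elements. *)
Record is_completed_lie_coalgebra (delta : L -> cprod (ftens V V)) : Prop := {
  clc_linear : linear delta;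
  clc_antisym : forall a, delta a = - cswap (delta a);
  clc_summable_r : forall a, ctmap_summable idL delta (delta a);
  clc_summable_l : forall a, ctmap_summable delta idL (delta a);
  clc_jacobi : forall a,
    ctmap idL delta (delta a) - cswap12 (ctmap idL delta (delta a))
    = cassoc (ctmap delta idL (delta a)) }.

Record is_completed_lie_bialgebra (br : L -> L -> L)
    (delta : L -> cprod (ftens V V)) : Prop := {
  clb_lie : is_lie_algebra br;
  clb_coalgebra : is_completed_lie_coalgebra delta;
  clb_summable_l : forall a b, ctmap_summable (ad br a) idL (delta b);
  clb_summable_r : forall a b, ctmap_summable idL (ad br a) (delta b);
  clb_cocycle : forall a b,
    delta (br a b) =
      (ctmap (ad br a) idL (delta b) + ctmap idL (ad br a) (delta b))
      - (ctmap (ad br b) idL (delta a) + ctmap idL (ad br b) (delta a)) }.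

End CompletedLie.

Section Affinization.
Variables (k : fieldType) (A : vectType k).

(* A (x) k[t, t^-1] as the direct sum of the A t^i, with a t^m = [mono a m] *)
Definition loop : int -> vectType k := fun=> A.
Definition mono (a : A) (m : int) : dsum loop := dinj loop m a.

Variables (mul : A -> A -> A) (delta : A -> tensor A A) (D Q : A -> A) (q : k).

Definition loop_bracket_mono (a : A) (m : int) (b : A) (n : int) : dsum loop :=
  mono (mul a (D b + q *: Q b)) (m + n - 1) *~ m
  - mono (mul b (D a + q *: Q a)) (m + n - 1) *~ n.

Definition loop_bracket (x y : dsum loop) : dsum loop :=
  dlift (fun m a => dlift (fun n b => loop_bracket_mono a m b n) y) x.

Definition loop_cobracket_mono (a : A) (m : int) : cprod (ftens loop loop) :=
  csum (fun i : int =>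
    tlift (fun a1 a2 =>
      (ctens (mono a1 (- i - 2)) (mono (Q a2 + q *: D a2) (m + i))
       - ctens (mono (Q a2 + q *: D a2) (m + i)) (mono a1 (- i - 2))) *~ (i + 1))
    (delta a)).

Definition loop_cobracket (x : dsum loop) : cprod (ftens loop loop) :=
  dlift (fun m a => loop_cobracket_mono a m) x.

Hypotheses (mul_bilinear : is_bilinear mul) (D_linear : linear D)
  (Q_linear : linear Q) (delta_linear : linear delta).

Let lin0 (U W : lmodType k) (f : U -> W) : linear f -> f 0 = 0.
Proof.
by move=> fl; have := fl (-1) 0 0; rewrite scaler0 addr0 scaleN1r addNr.
Qed.

Let mono0 m : mono 0 m = 0.
Proof.
apply: val_inj; apply: functional_extensionality_dep => j.
have [<-|mj] := eqVneq m j; first by rewrite /= dfwith_in.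
by rewrite /= dfwith_out.
Qed.

Lemma loop_bracketE a m b n :
  loop_bracket (mono a m) (mono b n) =
    mono (mul a (D b + q *: Q b)) (m + n - 1) *~ m
    - mono (mul b (D a + q *: Q a)) (m + n - 1) *~ n.
Proof.
have mul0 x : mul 0 x = 0 := lin0 (mul_bilinear.1 x).
have mulx0 x : mul x 0 = 0 := lin0 (mul_bilinear.2 x).
have P0 : D 0 + q *: Q 0 = 0 by rewrite (lin0 D_linear) (lin0 Q_linear) scaler0 addr0.
have br0 x i j : loop_bracket_mono x i 0 j = 0.
  by rewrite /loop_bracket_mono P0 mul0 mulx0 !mono0 !mul0rz subr0.
have br0l y i j : loop_bracket_mono 0 i y j = 0.
  by rewrite /loop_bracket_mono P0 mul0 mulx0 !mono0 !mul0rz subr0.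
rewrite /loop_bracket dlift_dinj => [|i]; first by rewrite dlift_dinj.
by rewrite dlift_dinj.
Qed.

Lemma loop_cobracketE a m :
  loop_cobracket (mono a m) =
  csum (fun i : int =>
    tlift (fun a1 a2 =>
      (ctens (mono a1 (- i - 2)) (mono (Q a2 + q *: D a2) (m + i))
       - ctens (mono (Q a2 + q *: D a2) (m + i)) (mono a1 (- i - 2))) *~ (i + 1))
    (delta a)).
Proof.
rewrite /loop_cobracket dlift_dinj // => i.
rewrite /loop_cobracket_mono (lin0 delta_linear).
apply: functional_extensionality_dep => p; rewrite /csum fsbig1 // => j _.
by rewrite (lin0 (tlift_linear _)).
Qed.

End Affinization.

(* Main.v *)
(* With E and P linear such that
     E(ab) = E(a)b,  P(ab) = P(a)b + aP(b) + E(ab),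
     delta E = (id (x) E) delta,  delta P = (P (x) id + id (x) P - 2 id (x) E) delta,
   put S = E - P.  The bracket m aP(b) - n bP(a) and the cobracket built from S
   then form a Lie bialgebra.  Case (a) is E = (D + Q)/2, P = D - Q/2: the
   admissibility axioms make D + Q commute with all multiplications.  In case
   (b), Q acts as -D wherever it occurs, so that E = 0, P = (1 - q)D work.
   The component of delta_L(x) at (t^u, t^v) is
     ((v+1) S (x) id - (u+1) id (x) S) delta(x_{u+v+2}),
   hence only finitely many terms contribute to each component of the sums in
   the axioms, and these become identities between elements of A, of A (x) A
   and of A (x) A (x) A, with the degrees as polynomial parameters. *)

Require Import Defs.
From mathcomp Require Import all_boot all_order all_algebra.
From mathcomp Require Import finmap ring zify.
From mathcomp Require Import boolp classical_sets functions cardinality fsbigop.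
From HB Require Import structures.

Set Implicit Arguments.
Unset Strict Implicit.
Unset Printing Implicit Defensive.

Import GRing.Theory VectorInternalTheory.
Local Open Scope ring_scope.

(** * Maps of tensor products *)

Section TensorMaps.
Variable k : fieldType.
Implicit Types U V W : vectType k.

(** [tlift] is a sum over coordinates of the tensor, so these maps are linear whatever [f] and [g]
    are. Linearity of [f] and [g] matters only for the value on pure tensors, as in [tmapE]. *)
HB.instance Definition _ U V U' V' (f : U -> U') (g : V -> V') :=
  GRing.isLinear.Build k (tensor U V) (tensor U' V') *:%R (tmap f g) (tlift_linear _).
HB.instance Definition _ U V :=
  GRing.isLinear.Build k (tensor U V) (tensor V U) *:%R (@tswap k U V) (tlift_linear _).
HB.instance Definition _ U V W :=
  GRing.isLinear.Build k _ _ *:%R (@tassoc k U V W) (tlift_linear _).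
HB.instance Definition _ U V W :=
  GRing.isLinear.Build k _ _ *:%R (@tswap12 k U V W) (tlift_linear _).
Lemma tensPl U V c (u u' : U) (v : V) :
  tens (c *: u + u') v = c *: tens u v + tens u' v.
Proof. exact: (tens_bilinear U V).1. Qed.

Lemma tensPr U V c (u : U) (v v' : V) :
  tens u (c *: v + v') = c *: tens u v + tens u v'.
Proof. exact: (tens_bilinear U V).2. Qed.

Lemma tens0l U V (v : V) : tens (0 : U) v = 0.
Proof. by have := tensPl (-1) (0 : U) 0 v; rewrite scaler0 addr0 scaleN1r addNr. Qed.

Lemma tens0r U V (u : U) : tens u (0 : V) = 0.
Proof. by have := tensPr (-1) u (0 : V) 0; rewrite scaler0 addr0 scaleN1r addNr. Qed.

Lemma tmapE U V U' V' (f : {linear U -> U'}) (g : {linear V -> V'}) u v :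
  tmap f g (tens u v) = tens (f u) (g v).
Proof.
rewrite /tmap tlift_tens //; split=> [w c x y|w c x y].
  by rewrite (linearP f) tensPl.
by rewrite (linearP g) tensPr.
Qed.

Lemma tswapE U V (u : U) (v : V) : tswap (tens u v) = tens v u.
Proof.
by rewrite /tswap tlift_tens //; split=> [w c x y|w c x y]; rewrite ?tensPl ?tensPr.
Qed.

(** [tlift] evaluates its function on pairs of basis vectors only, so no bilinearity of [f] and [f']
    enters. *)
Lemma tlift_funP U V (W : lmodType k) c (f f' : U -> V -> W) x :
  tlift (fun u v => c *: f u v + f' u v) x = c *: tlift f x + tlift f' x.
Proof.
rewrite /tlift scaler_sumr -big_split; apply: eq_bigr => i _ /=.
rewrite scaler_sumr -big_split; apply: eq_bigr => j _ /=.
by rewrite scalerDr !scalerA mulrC.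
Qed.

Lemma eq_tlift U V (W : lmodType k) (f f' : U -> V -> W) x :
  (forall u v, f u v = f' u v) -> tlift f x = tlift f' x.
Proof. by move=> ff; apply: eq_bigr => i _; apply: eq_bigr => j _; rewrite ff. Qed.

Lemma tassocE U V W (u : U) (v : V) (w : W) :
  tassoc (tens (tens u v) w) = tens u (tens v w).
Proof.
have bl (w' : W) : is_bilinear (fun (u : U) (v : V) => tens u (tens v w')).
  by split=> [? c x y|? c x y]; rewrite !(tensPl, tensPr).
rewrite /tassoc tlift_tens ?tlift_tens //; split=> [w'|x c w1 w2].
  exact: tlift_linear.
by rewrite -tlift_funP; apply: eq_tlift => *; rewrite !tensPr.
Qed.

Lemma tswap12E U V W (u : U) (v : V) (w : W) :
  tswap12 (tens u (tens v w)) = tens v (tens u w).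
Proof.
have bl (u' : U) : is_bilinear (fun (v : V) (w : W) => tens v (tens u' w)).
  by split=> [? c x y|? c x y]; rewrite !(tensPl, tensPr).
rewrite /tswap12 tlift_tens ?tlift_tens //; split=> [y c u1 u2|u'].
  by rewrite -tlift_funP; apply: eq_tlift => *; rewrite tensPl tensPr.
exact: tlift_linear.
Qed.

Lemma eq_tmap U V U' V' (f f' : U -> U') (g g' : V -> V') :
  f =1 f' -> g =1 g' -> tmap f g =1 tmap f' g'.
Proof. by move=> ff gg x; apply: eq_tlift => u v; rewrite ff gg. Qed.

Lemma tmapPl U V U' V' (c : k) (f f' : U -> U') (g : V -> V') x :
  tmap (fun u => c *: f u + f' u) g x = c *: tmap f g x + tmap f' g x.
Proof. by rewrite -tlift_funP; apply: eq_tlift => *; rewrite tensPl. Qed.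

Lemma tmapPr U V U' V' (c : k) (f : U -> U') (g g' : V -> V') x :
  tmap f (fun u => c *: g u + g' u) x = c *: tmap f g x + tmap f g' x.
Proof. by rewrite -tlift_funP; apply: eq_tlift => *; rewrite tensPr. Qed.

Lemma tmap0l U V U' V' (f : U -> U') (g : V -> V') x :
  f =1 (fun=> 0) -> tmap f g x = 0.
Proof.
move=> f0; rewrite /tmap /tlift big1 // => i _; rewrite big1 // => j _.
by rewrite f0 tens0l scaler0.
Qed.

Lemma tmap0r U V U' V' (f : U -> U') (g : V -> V') x :
  g =1 (fun=> 0) -> tmap f g x = 0.
Proof.
move=> g0; rewrite /tmap /tlift big1 // => i _; rewrite big1 // => j _.
by rewrite g0 tens0r scaler0.
Qed.

Lemma tmapDl U V U' V' (f f' : U -> U') (g : V -> V') x :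
  tmap (fun u => f u + f' u) g x = tmap f g x + tmap f' g x.
Proof.
by rewrite -[tmap f g x]scale1r -tmapPl; apply: eq_tmap => // u; rewrite scale1r.
Qed.

Lemma tmapDr U V U' V' (f : U -> U') (g g' : V -> V') x :
  tmap f (fun v => g v + g' v) x = tmap f g x + tmap f g' x.
Proof.
by rewrite -[tmap f g x]scale1r -tmapPr; apply: eq_tmap => // v; rewrite scale1r.
Qed.

Lemma tmapZl U V U' V' c (f : U -> U') (g : V -> V') x :
  tmap (fun u => c *: f u) g x = c *: tmap f g x.
Proof.
rewrite -[RHS]addr0 -(@tmap0l U V U' V' (fun=> 0) g x) // -tmapPl.
by apply: eq_tmap => // u; rewrite addr0.
Qed.

Lemma tmapZr U V U' V' c (f : U -> U') (g : V -> V') x :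
  tmap f (fun v => c *: g v) x = c *: tmap f g x.
Proof.
rewrite -[RHS]addr0 -(@tmap0r U V U' V' f (fun=> 0) x) // -tmapPr.
by apply: eq_tmap => // v; rewrite addr0.
Qed.

Lemma tmapBl U V U' V' (f f' : U -> U') (g : V -> V') x :
  tmap (fun u => f u - f' u) g x = tmap f g x - tmap f' g x.
Proof.
rewrite addrC -scaleN1r -tmapPl.
by apply: eq_tmap => // u; rewrite scaleN1r addrC.
Qed.

Lemma tmapBr U V U' V' (f : U -> U') (g g' : V -> V') x :
  tmap f (fun v => g v - g' v) x = tmap f g x - tmap f g' x.
Proof.
rewrite addrC -scaleN1r -tmapPr.
by apply: eq_tmap => // v; rewrite scaleN1r addrC.
Qed.

Lemma tmap_id U V (x : tensor U V) : tmap id id x = x.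
Proof.
apply: (tens_ext (h1 := tmap id id) (h2 := id)) => // [|u v].
  exact: tlift_linear.
exact: (tmapE idfun idfun).
Qed.

Lemma tmap_comp U V U' V' U'' V'' (f : {linear U' -> U''}) (g : {linear V' -> V''})
    (f' : {linear U -> U'}) (g' : {linear V -> V'}) x :
  tmap f g (tmap f' g' x) = tmap (f \o f') (g \o g') x.
Proof.
apply: (tens_ext (h1 := tmap f g \o tmap f' g')) x => [||u v] /=.
- exact: linearP.
- exact: linearP.
- by rewrite !tmapE.
Qed.

Lemma tswap_tmap U V U' V' (f : {linear U -> U'}) (g : {linear V -> V'}) x :
  tswap (tmap f g x) = tmap g f (tswap x).
Proof.
apply: (tens_ext (h1 := tswap \o tmap f g) (h2 := tmap g f \o tswap)) x => [||u v] /=.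
- exact: linearP.
- exact: linearP.
- by rewrite !tmapE !tswapE tmapE.
Qed.

Lemma tassoc_tmap U V W U' V' W' (f : {linear U -> U'}) (g : {linear V -> V'})
    (h : {linear W -> W'}) x :
  tassoc (tmap (tmap f g) h x) = tmap f (tmap g h) (tassoc x).
Proof.
pose L := {linear tensor (tensor U V) W -> tensor U' (tensor V' W')}.
pose h1 : L := tassoc \o tmap (tmap f g) h; pose h2 : L := tmap f (tmap g h) \o tassoc.
apply: (tens_ext (h1 := h1) (h2 := h2)) x => [||y w]; [exact: linearP..|].
(* A second use of [tens_ext], in the inner tensor with [w] fixed, reduces the claim to pure triple
   tensors. *)
pose g1 y := h1 (tens y w); pose g2 y := h2 (tens y w).
apply: (tens_ext (h1 := g1) (h2 := g2)) y => [a y z|a y z|u v].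
- by rewrite /g1 tensPl (linearP h1).
- by rewrite /g2 tensPl (linearP h2).
- by rewrite /g1 /g2 /h1 /h2 /= tmapE /= tmapE !tassocE tmapE /= tmapE.
Qed.

Lemma tswap12_tmap U V W U' V' W' (f : {linear U -> U'}) (g : {linear V -> V'})
    (h : {linear W -> W'}) x :
  tswap12 (tmap f (tmap g h) x) = tmap g (tmap f h) (tswap12 x).
Proof.
pose L := {linear tensor U (tensor V W) -> tensor V' (tensor U' W')}.
pose h1 : L := tswap12 \o tmap f (tmap g h); pose h2 : L := tmap g (tmap f h) \o tswap12.
apply: (tens_ext (h1 := h1) (h2 := h2)) x => [||u y]; [exact: linearP..|].
pose g1 y := h1 (tens u y); pose g2 y := h2 (tens u y).
apply: (tens_ext (h1 := g1) (h2 := g2)) y => [a y z|a y z|v w].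
- by rewrite /g1 tensPr (linearP h1).
- by rewrite /g2 tensPr (linearP h2).
- by rewrite /g1 /g2 /h1 /h2 /= tmapE /= tmapE !tswap12E tmapE /= tmapE.
Qed.

(** Carries the symmetry of a left inner factor over to right-bracketed tensors; it will make the
    iterated coproduct symmetric in its first two slots. *)
Lemma tswap12_tassoc U V W (x : tensor (tensor U V) W) :
  tswap12 (tassoc x) = tassoc (tmap tswap id x).
Proof.
pose L := {linear tensor (tensor U V) W -> tensor V (tensor U W)}.
pose h1 : L := tswap12 \o tassoc; pose h2 : L := tassoc \o tmap tswap (@idfun W).
apply: (tens_ext (h1 := h1) (h2 := h2)) x => [||y w]; [exact: linearP..|].
pose g1 y := h1 (tens y w); pose g2 y := h2 (tens y w).
apply: (tens_ext (h1 := g1) (h2 := g2)) y => [a y z|a y z|u v].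
- by rewrite /g1 tensPl (linearP h1).
- by rewrite /g2 tensPl (linearP h2).
- by rewrite /g1 /g2 /h1 /h2 /= tassocE tmapE /= tswap12E tswapE tassocE.
Qed.

End TensorMaps.

(** * Direct sums *)

Section FiniteSums.
Variable k : fieldType.

Lemma fset_sum1 (W : zmodType) (T : choiceType) (A : {fset T}) (F : T -> W) t0 :
  (t0 \notin A -> F t0 = 0) -> (forall t, t != t0 -> F t = 0) ->
  \sum_(t <- A) F t = F t0.
Proof.
move=> F0 Fn; have [t0A|t0A] := boolP (t0 \in A); last first.
  rewrite F0 // big1_seq // => t /= tA; apply: Fn.
  by apply: contraNneq t0A => <-.
rewrite (big_fsetD1 t0) //= big1_seq ?addr0 // => t /=.
by rewrite in_fsetD1 => /andP[tt0 _]; apply: Fn.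
Qed.

Lemma fsum1 (W : zmodType) (T : choiceType) (F : T -> W) (t0 : T) :
  (forall t, t != t0 -> F t = 0) -> \sum_(t \in [set: T]) F t = F t0.
Proof.
move=> F0; rewrite (fsbigTE [fset t0]%fset) ?big_seq_fset1 // => t.
by rewrite inE => /F0.
Qed.

(** Both supports must be finite: over an infinite support the sum takes the default value 0, and
    additivity can fail. *)
Lemma fsumP (W : lmodType k) (T : choiceType) (c : k) (F G : T -> W) :
  finite_set [set t | F t != 0]%classic -> finite_set [set t | G t != 0]%classic ->
  \sum_(t \in [set: T]) (c *: F t + G t) =
  c *: \sum_(t \in [set: T]) F t + \sum_(t \in [set: T]) G t.
Proof.
move=> finF finG; pose A := (fset_set [set t | F t != 0]%classic `|`
  fset_set [set t | G t != 0]%classic)%fset.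
have A0 t : t \notin A -> F t = 0 /\ G t = 0.
  rewrite in_fsetU !in_fset_set // negb_or => /andP[]; rewrite !notin_setE /=.
  by move=> /negP/negPn/eqP -> /negP/negPn/eqP ->.
rewrite !(fsbigTE A); first by rewrite big_split -scaler_sumr.
- by move=> t /A0[].
- by move=> t /A0[].
- by move=> t /A0[-> ->]; rewrite scaler0 addr0.
Qed.

End FiniteSums.

Lemma linear_at0 (R : pzRingType) (U W : lmodType R) (f : U -> W) :
  linear f -> f 0 = 0.
Proof. by move=> fl; have := fl (-1) 0 0; rewrite scaler0 addr0 scaleN1r addNr. Qed.

Section DirectSumTheory.
Variables (k : fieldType) (I : choiceType) (V : I -> vectType k).

Lemma cprodP (x y : cprod V) : (forall i, x i = y i) -> x = y.
Proof. exact: functional_extensionality_dep. Qed.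

Lemma dsumP (x y : dsum V) : (forall i, x i = y i) -> x = y.
Proof. by move=> xy; apply/val_inj/cprodP. Qed.

Lemma finite_dsum (x : dsum V) : finite_set [set i | x i != 0]%classic.
Proof. by apply/asboolP; apply: dsum_valP. Qed.

Definition dsupp (x : dsum V) : {fset I} := fset_set [set i | x i != 0]%classic.

Lemma dsupp_out (x : dsum V) i : i \notin dsupp x -> x i = 0.
Proof.
rewrite in_fset_set; last exact: finite_dsum.
by rewrite notin_setE /= => /negP/negPn/eqP.
Qed.

(** Evaluation at an index as a map of its own, so that it can carry a linear structure and pass
    through sums. *)
Definition cproj i (x : cprod V) : V i := x i.
Fact cproj_linear i : linear (cproj i). Proof. by []. Qed.
HB.instance Definition _ i :=
  GRing.isLinear.Build k (cprod V) (V i) *:%R (cproj i) (@cproj_linear i).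

Lemma dsum_valE (x : dsum V) i : dsum_val x i = x i. Proof. by []. Qed.

Fact dsum_val_linear : linear (@dsum_val k I V). Proof. by []. Qed.
HB.instance Definition _ :=
  GRing.isLinear.Build k (dsum V) (cprod V) *:%R (@dsum_val k I V) dsum_val_linear.

Lemma dsumPE c (x y : dsum V) i : (c *: x + y) i = c *: x i + y i.
Proof. by []. Qed.

Section Lift.
Variables (W : lmodType k) (f : forall i, V i -> W).
Hypothesis f0 : forall i, @f i 0 = 0.

Lemma dliftE (x : dsum V) (A : {fset I}) : (dsupp x `<=` A)%fset ->
  dlift f x = \sum_(i <- A) f (x i).
Proof.
move=> /fsubsetP xA; rewrite /dlift (fsbigTE A) // => i iA.
by rewrite dsupp_out //; apply: contra iA => /xA.
Qed.

Lemma linear_dlift (W' : lmodType k) (h : {linear W -> W'}) x :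
  h (dlift f x) = \sum_(i \in [set: I]) h (f (x i)).
Proof.
rewrite (dliftE (fsubset_refl _)) linear_sum (fsbigTE (dsupp x)) // => i.
by move/dsupp_out ->; rewrite f0 linear0.
Qed.
End Lift.

Lemma eq_dlift (W : lmodType k) (f g : forall i, V i -> W) x :
  (forall i (v : V i), f i v = g i v) -> dlift f x = dlift g x.
Proof. by move=> fg; rewrite /dlift; apply: eq_fsbigr => i _; apply: fg. Qed.

Lemma dlift_funP (W : lmodType k) c (f g : forall i, V i -> W) x :
  (forall i, f i 0 = 0) -> (forall i, g i 0 = 0) ->
  dlift (fun i v => c *: f i v + g i v) x = c *: dlift f x + dlift g x.
Proof.
move=> f0 g0; rewrite !(dliftE _ (fsubset_refl _)) //.
  by rewrite big_split -scaler_sumr.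
by move=> i; rewrite f0 g0 scaler0 addr0.
Qed.

Lemma dlift_linear (W : lmodType k) (f : forall i, V i -> W) :
  (forall i, linear (f i)) -> linear (dlift f).
Proof.
move=> fl; have f0 i : f i 0 = 0 := linear_at0 (fl i).
move=> c x y; pose A := (dsupp x `|` dsupp y)%fset.
rewrite (dliftE f0 (fsubsetUl (dsupp x) (dsupp y))).
rewrite (dliftE f0 (fsubsetUr (dsupp x) (dsupp y))).
rewrite /dlift (fsbigTE A) => [|i].
  rewrite scaler_sumr -big_split; apply: eq_bigr => i _.
  by rewrite dsumPE fl.
rewrite in_fsetU negb_or => /andP[/dsupp_out xi /dsupp_out yi].
by rewrite dsumPE xi yi scaler0 addr0.
Qed.

Lemma dinj_in i (v : V i) : dinj V i v i = v.
Proof. by rewrite /dinj /dsum_fun /= dfwith_in. Qed.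

Lemma dinj_out i (v : V i) j : i != j -> dinj V i v j = 0.
Proof. by move=> ij; rewrite /dinj /dsum_fun /= dfwith_out. Qed.

Fact dinj_linear i : linear (dinj V i).
Proof.
move=> c u v; apply: dsumP => j; rewrite dsumPE.
have [<-|ij] := eqVneq i j; first by rewrite !dinj_in.
by rewrite !dinj_out // scaler0 addr0.
Qed.
HB.instance Definition _ i :=
  GRing.isLinear.Build k (V i) (dsum V) *:%R (dinj V i) (@dinj_linear i).

Lemma dsum_dinj (x : dsum V) : x = \sum_(i <- dsupp x) dinj V i (x i).
Proof.
apply: dsumP => j; rewrite -!dsum_valE linear_sum -[RHS]/(cproj _ _) linear_sum.
rewrite (fset_sum1 (t0 := j)) => [|/dsupp_out ->|i ij].
- exact: (esym (dinj_in _)).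
- by rewrite !linear0.
- exact: dinj_out.
Qed.

(** The reduction to monomials: an identity on the loop space is phrased as the vanishing of a map
    linear in each variable, and this lemma is applied once per variable. *)
Lemma dsum_lin0 (W : lmodType k) (h : dsum V -> W) :
  linear h -> (forall i v, h (dinj V i v) = 0) -> forall x, h x = 0.
Proof.
move=> hl h0 x; pose H : {linear dsum V -> W} :=
  HB.pack h (GRing.isLinear.Build _ _ _ _ h hl).
by rewrite (dsum_dinj x) -[h]/(H : _ -> _) linear_sum big1.
Qed.

End DirectSumTheory.

(** * The Jacobi identity *)

(** The coordinate functionals separate points. This turns a vector identity into a scalar one,
    where [ring] or [field] applies once [scalarE] has pushed the functional down to the atoms. *)
Lemma scalar_ext (k : fieldType) (W : vectType k) (x y : W) :
  (forall phi : {scalar W}, phi x = phi y) -> x = y.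
Proof.
move=> xy; apply: (can_inj v2rK); apply/rowP => j.
have cl : scalar (fun z : W => v2r z 0 j) by move=> c u v; rewrite linearP !mxE.
pose phi : {scalar W} :=
  HB.pack (fun z : W => v2r z 0 j) (GRing.isLinear.Build _ _ _ _ _ cl).
exact: xy phi.
Qed.

Lemma scalarE (k : fieldType) (W : vectType k) (phi : {scalar W}) :
  (forall x y, phi (x + y) = phi x + phi y) * (forall x, phi (- x) = - phi x)
  * (forall c x, phi (c *: x) = c * phi x) * (forall x n, phi (x *+ n) = phi x *+ n).
Proof.
by do !split=> *; rewrite ?(linearD, linearN, linearZ_LR, linearMn).
Qed.

Lemma linE (R : pzRingType) (U V : lmodType R) (f : {linear U -> V}) :
  (forall x y, f (x + y) = f x + f y) * (forall x, f (- x) = - f x)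
  * (forall c x, f (c *: x) = c *: f x).
Proof. by do !split=> *; rewrite ?(linearD, linearN, linearZ_LR). Qed.

Section LieIdentity.
Variables (k : fieldType) (A : vectType k) (mul : {bilinear A -> A -> A}).
Variables (E P : {linear A -> A}).
Hypotheses (mulA : associative mul) (mulC : commutative mul).
Hypothesis E_mul : forall a b, E (mul a b) = mul (E a) b.
Hypothesis P_mul : forall a b, P (mul a b) = mul (P a) b + mul a (P b) + E (mul a b).

(** The coefficient of the bracket of [a t^m] and [b t^n]. The degrees are taken in [k], so that
    identities become polynomial in them. *)
Definition loop_bk (m : k) (a : A) (n : k) (b : A) : A :=
  m *: mul a (P b) - n *: mul b (P a).

Lemma loop_bk_jacobi (m n p : k) (a b c : A) :
  loop_bk m a (n + p - 1) (loop_bk n b p c)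
  + loop_bk n b (p + m - 1) (loop_bk p c m a)
  + loop_bk p c (m + n - 1) (loop_bk m a n b) = 0.
Proof.
(* The rule for [P] gives [x P(u P(v)) = t x u v + s x u v], the part in [E] being absorbed in [s].
   After the symmetries [tC] and [sC], the coefficients of each [t] and each [s] cancel over the
   cyclic sum. *)
pose t x y z := mul x (mul (P y) (P z)).
pose s x y z := mul x (mul y (P (P z) + E (P z))).
have tC x y z : t x y z = t x z y by rewrite /t (mulC (P y)).
have sC x y z : s x y z = s y x z by rewrite /s !mulA (mulC x).
have bkE m1 n1 p1 N x y z : loop_bk m1 x N (loop_bk n1 y p1 z) =
    m1 *: (n1 *: (t x y z + s x y z) - p1 *: (t x z y + s x z y))
    - N *: (n1 *: t y z x - p1 *: t z y x).
  rewrite /loop_bk; congr (_ *: _ - _ *: _).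
    have Pmul u v : mul x (P (mul u (P v))) = t x u v + s x u v.
      rewrite P_mul -addrA linearDr; congr (_ + _).
      by rewrite (mulC u (P v)) E_mul -(mulC u) -linearDr.
    by rewrite linearB 2!linearZ linearBr /= 2!linearZr_LR /= !Pmul.
  by rewrite linearBl /= 2!linearZl_LR /= /t !mulA.
rewrite !bkE (tC b c a) (tC c b a) (tC a c b) (sC c a b) (sC c b a) (sC b a c).
apply: scalar_ext => phi.
by rewrite !(scalarE phi) linear0; ring.
Qed.

End LieIdentity.

(** * The co-Jacobi identity *)

(** Here [z] models the iterated coproduct, [s1], [s2], [s3] the operator [S] on each slot, and [e]
    the correction coming from [E]. Then [x1], [x2], [x3] are the three outer cobrackets after
    [delta] has been applied to one of their factors. As the [s]'s commute, only a polynomial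
    identity in the degrees remains. *)
Lemma cobracket_jacobi_identity (k : fieldType) (W : vectType k)
    (s1 s2 s3 : {linear W -> W}) (z e : W) (u v w : k) :
  s2 (s1 z) = s1 (s2 z) -> s3 (s1 z) = s1 (s3 z) -> s3 (s2 z) = s2 (s3 z) ->
  let x1 := (v + w + 2 + 1) *: s1 z - (u + 1) *: (s2 z + s3 z + e) in
  let x2 := (u + w + 2 + 1) *: s2 z - (v + 1) *: (s1 z + s3 z + e) in
  let x3 := (w + 1) *: (s1 z + s2 z + e) - (u + v + 2 + 1) *: s3 z in
  ((w + 1) *: s2 x1 - (v + 1) *: s3 x1) - ((w + 1) *: s1 x2 - (u + 1) *: s3 x2)
  = (v + 1) *: s1 x3 - (u + 1) *: s2 x3.
Proof.
move=> s21 s31 s32 /=; rewrite !(linE s1, linE s2, linE s3) s21 s31 s32.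
by apply: scalar_ext => phi; rewrite !(scalarE phi); ring.
Qed.

Section LieCoidentity.
Variables (k : fieldType) (A : vectType k) (delta : {linear A -> tensor A A}).
Variables (E S : {linear A -> A}).
Hypothesis coA : forall a, tassoc (tmap delta id (delta a)) = tmap id delta (delta a).
Hypothesis coC : forall a, tswap (delta a) = delta a.
Hypothesis coE : forall a, delta (E a) = tmap id E (delta a).
Hypothesis coS : forall a,
  delta (S a) = tmap S id (delta a) + tmap id S (delta a) + tmap id E (delta a).

Definition loop_cobk (u v : k) (x : tensor A A) : tensor A A :=
  (v + 1) *: tmap S id x - (u + 1) *: tmap id S x.

Fact loop_cobk_linear u v : linear (loop_cobk u v).
Proof.
move=> c x y; rewrite /loop_cobk (linearP (tmap S idfun)) (linearP (tmap idfun S)).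
by apply: scalar_ext => phi; rewrite !(scalarE phi); ring.
Qed.
HB.instance Definition _ u v :=
  GRing.isLinear.Build k _ _ *:%R (loop_cobk u v) (loop_cobk_linear u v).

(** By cocommutativity, [E] on one slot of a coproduct may be moved to the other. *)
Lemma coE_l a : tmap E id (delta a) = tmap id E (delta a).
Proof. by rewrite -{1}coC -(tswap_tmap idfun E) -coE coC. Qed.

Lemma tswap_cobk u v a :
  tswap (loop_cobk v u (delta a)) = - loop_cobk u v (delta a).
Proof.
pose sw : {linear tensor A A -> tensor A A} := tswap.
rewrite -[LHS]/(sw _) /loop_cobk linearB !(linearZ_LR sw) opprB /sw /=.
by rewrite (tswap_tmap S idfun) (tswap_tmap idfun S) coC.
Qed.

Notation T3 := (tensor A (tensor A A)).
Notation at1 f := (tmap f (@idfun (tensor A A))).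
Notation at2 f := (tmap (@idfun A) (tmap f (@idfun A))).
Notation at3 f := (tmap (@idfun A) (tmap (@idfun A) f)).

Let at12 (f g : {linear A -> A}) (z : T3) : at2 g (at1 f z) = at1 f (at2 g z).
Proof. by rewrite !tmap_comp; apply: eq_tmap. Qed.

Let at13 (f g : {linear A -> A}) (z : T3) : at3 g (at1 f z) = at1 f (at3 g z).
Proof. by rewrite !tmap_comp; apply: eq_tmap. Qed.

Let at23 (f g : {linear A -> A}) (z : T3) : at3 g (at2 f z) = at2 f (at3 g z).
Proof.
by rewrite !tmap_comp; apply: eq_tmap => // x; rewrite /= !tmap_comp; apply: eq_tmap.
Qed.

Let at_sw1 (f : {linear A -> A}) (z : T3) : tswap12 (at1 f z) = at2 f (tswap12 z).
Proof.
rewrite -(tswap12_tmap f idfun idfun); congr tswap12.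
by apply: eq_tmap => // x; rewrite /= tmap_id.
Qed.

Let at_sw2 (f : {linear A -> A}) (z : T3) : tswap12 (at2 f z) = at1 f (tswap12 z).
Proof.
by rewrite (tswap12_tmap idfun f idfun); apply: eq_tmap => // x; rewrite /= tmap_id.
Qed.

Let at_sw3 (f : {linear A -> A}) (z : T3) : tswap12 (at3 f z) = at3 f (tswap12 z).
Proof. exact: (tswap12_tmap idfun idfun f). Qed.

Let ass1 (f : {linear A -> A}) (x : tensor (tensor A A) A) :
  tassoc (tmap (tmap f id) id x) = at1 f (tassoc x).
Proof.
by rewrite (tassoc_tmap f idfun idfun); apply: eq_tmap => // y; rewrite /= tmap_id.
Qed.

Let ass2 (f : {linear A -> A}) (x : tensor (tensor A A) A) :
  tassoc (tmap (tmap id f) id x) = at2 f (tassoc x).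
Proof. exact: (tassoc_tmap idfun f idfun). Qed.

Let ass3 (f : {linear A -> A}) (x : tensor (tensor A A) A) :
  tassoc (tmap id f x) = at3 f (tassoc x).
Proof.
rewrite -(tassoc_tmap idfun idfun f); congr tassoc.
by apply: eq_tmap => // y; rewrite /= tmap_id.
Qed.

Let tmap_cobkr v w (z : T3) :
  tmap (@idfun A) (loop_cobk v w) z = (w + 1) *: at2 S z - (v + 1) *: at3 S z.
Proof. by rewrite tmapBr !tmapZr. Qed.

Let tmap_cobkl u v (x : tensor (tensor A A) A) :
  tassoc (tmap (loop_cobk u v) (@idfun A) x)
  = (v + 1) *: at1 S (tassoc x) - (u + 1) *: at2 S (tassoc x).
Proof. by rewrite tmapBl !tmapZl linearB !linearZ /= ass1 ass2. Qed.

Section At.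
Variable a : A.
Let Z : T3 := tmap (@idfun A) delta (delta a).

(** [coE_l] moves [E] from slot 1 to the outer right factor; there [coE] and [coE_l] take it inside
    the inner coproduct, into slot 2. *)
Let ZE2 : at2 E Z = at1 E Z.
Proof.
transitivity (tmap id delta (tmap E id (delta a))); last first.
  by rewrite /Z (tmap_comp idfun delta E idfun) tmap_comp; apply: eq_tmap.
rewrite coE_l /Z (tmap_comp idfun delta idfun E) tmap_comp; apply: eq_tmap => // b /=.
by rewrite coE coE_l.
Qed.

Let ZE3 : at3 E Z = at1 E Z.
Proof. by rewrite -ZE2 /Z !tmap_comp; apply: eq_tmap => // b /=; rewrite coE_l. Qed.

(** By coassociativity [Z] is also the left-bracketed iterated coproduct, where the swap acts on the
    inner, cocommutative [delta]. *)
Let Zsw : tswap12 Z = Z.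
Proof.
rewrite /Z -coA tswap12_tassoc (tmap_comp tswap idfun delta idfun); congr tassoc.
by apply: eq_tmap => // b /=; rewrite coC.
Qed.

Let dS1 : tmap id delta (tmap S id (delta a)) = at1 S Z.
Proof. by rewrite (tmap_comp idfun delta S idfun) tmap_comp; apply: eq_tmap. Qed.

(** The correction in [E] is normalised to slot 1 here and in [aS1], so that it becomes the single
    [e] of [cobracket_jacobi_identity]. *)
Let dS2 : tmap id delta (tmap id S (delta a)) = at2 S Z + at3 S Z + at1 E Z.
Proof.
rewrite -ZE3 /Z (tmap_comp idfun delta idfun S) !tmap_comp -!tmapDr.
by apply: eq_tmap => // b; rewrite /= coS.
Qed.

Let aS3 : tassoc (tmap delta id (tmap id S (delta a))) = at3 S Z.
Proof.
rewrite /Z -coA -ass3 (tmap_comp delta idfun idfun S) (tmap_comp idfun S delta idfun).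
by congr tassoc; apply: eq_tmap.
Qed.

Let aS1 : tassoc (tmap delta id (tmap S id (delta a))) = at1 S Z + at2 S Z + at1 E Z.
Proof.
rewrite -ZE2 /Z -coA -ass1 -!ass2 -!linearD; congr tassoc.
rewrite (tmap_comp delta idfun S idfun).
rewrite (tmap_comp (tmap S idfun) idfun delta idfun).
rewrite (tmap_comp (tmap idfun S) idfun delta idfun).
rewrite (tmap_comp (tmap idfun E) idfun delta idfun).
by rewrite -!tmapDl; apply: eq_tmap => // b; rewrite /= coS.
Qed.

(** Applying [delta] to a factor of the outer cobracket yields slot operators on [Z], and the inner
    cobracket adds one more [S]. The degree [v + w + 2] is the one whose cobracket has a component
    at [(v, w)], and likewise for the others. *)
Lemma loop_cobk_jacobi (u v w : k) :
  tmap id (loop_cobk v w \o delta) (loop_cobk u (v + w + 2) (delta a))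
  - tswap12 (tmap id (loop_cobk u w \o delta) (loop_cobk v (u + w + 2) (delta a)))
  = tassoc (tmap (loop_cobk u v \o delta) id (loop_cobk (u + v + 2) w (delta a))).
Proof.
have r u1 v1 x : tmap id (loop_cobk u1 v1 \o delta) x =
    tmap idfun (loop_cobk u1 v1) (tmap id delta x).
  by rewrite (tmap_comp idfun (loop_cobk u1 v1) idfun delta); apply: eq_tmap.
have l u1 v1 x : tmap (loop_cobk u1 v1 \o delta) id x =
    tmap (loop_cobk u1 v1) idfun (tmap delta id x).
  by rewrite (tmap_comp (loop_cobk u1 v1) idfun delta idfun); apply: eq_tmap.
have J1 u1 v1 : tmap id delta (loop_cobk u1 v1 (delta a)) =
    (v1 + 1) *: at1 S Z - (u1 + 1) *: (at2 S Z + at3 S Z + at1 E Z).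
  rewrite /loop_cobk linearB 2!linearZ /=.
  by rewrite dS1 dS2.
have J2 u1 v1 : tassoc (tmap delta id (loop_cobk u1 v1 (delta a))) =
    (v1 + 1) *: (at1 S Z + at2 S Z + at1 E Z) - (u1 + 1) *: at3 S Z.
  pose h : {linear tensor A A -> T3} := tassoc \o tmap delta idfun.
  rewrite -[LHS]/(h _) /loop_cobk linearB 2!linearZ /= aS1 aS3.
  by [].
have sw x : tswap12 (tmap idfun (loop_cobk u w) x) =
    (w + 1) *: at1 S (tswap12 x) - (u + 1) *: at3 S (tswap12 x).
  rewrite tmap_cobkr linearB 2!linearZ.
  by congr (_ *: _ - _ *: _); [exact: at_sw2 | exact: at_sw3].
(* The swap fixes [Z] and exchanges slots 1 and 2; the term in [E] lands in slot 2, and [ZE2] brings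
   it back to slot 1. *)
have J3 u1 v1 : tswap12 ((v1 + 1) *: at1 S Z - (u1 + 1) *: (at2 S Z + at3 S Z + at1 E Z))
   = (v1 + 1) *: at2 S Z - (u1 + 1) *: (at1 S Z + at3 S Z + at1 E Z).
  rewrite linearB 2!linearZ; congr (_ *: _ - _ *: _).
    by rewrite -[in RHS]Zsw; exact: at_sw1.
  rewrite 2!linearD; congr (_ + _ + _).
  - by rewrite -[in RHS]Zsw; exact: at_sw2.
  - by rewrite -[in RHS]Zsw; exact: at_sw3.
  - by rewrite -[RHS]ZE2 -[in RHS]Zsw; exact: at_sw1.
rewrite !r l tmap_cobkl J1 J2 sw J1 J3 tmap_cobkr.
apply: (cobracket_jacobi_identity (s1 := at1 S) (s2 := at2 S) (s3 := at3 S)).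
- exact: at12.
- exact: at13.
- exact: at23.
Qed.
End At.
End LieCoidentity.

(** * The cocycle condition *)

Section CocycleIdentity.
(** A model of [W = A (x) A] with [d] the coproduct: [l1 a], [p1], [e1], [s1] stand for
    multiplication by [a], [P], [E], [S] on the first slot, and the index 2 for the second slot.
    Without explicit tensors, normalisation is plain rewriting. *)
Variables (k : fieldType) (A W : vectType k) (d : A -> W).
Variables (E P : A -> A) (l1 l2 : A -> {linear W -> W}) (p1 p2 e1 e2 s1 s2 : {linear W -> W}).

Hypotheses
  (p1l1 : forall a z, p1 (l1 a z) = l1 (P a) z + l1 a (p1 z) + l1 (E a) z)
  (p2l2 : forall a z, p2 (l2 a z) = l2 (P a) z + l2 a (p2 z) + l2 (E a) z)
  (p1l2 : forall a z, p1 (l2 a z) = l2 a (p1 z))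
  (p2l1 : forall a z, p2 (l1 a z) = l1 a (p2 z))
  (e1l1 : forall a z, e1 (l1 a z) = l1 (E a) z)
  (e2l2 : forall a z, e2 (l2 a z) = l2 (E a) z)
  (l1e1 : forall a z, l1 a (e1 z) = l1 (E a) z)
  (l2e2 : forall a z, l2 a (e2 z) = l2 (E a) z)
  (e1l2 : forall a z, e1 (l2 a z) = l2 a (e1 z))
  (e2l1 : forall a z, e2 (l1 a z) = l1 a (e2 z))
  (p2p1 : forall z, p2 (p1 z) = p1 (p2 z))
  (e1p2 : forall z, e1 (p2 z) = p2 (e1 z))
  (e2p1 : forall z, e2 (p1 z) = p1 (e2 z))
  (e2e1 : forall z, e2 (e1 z) = e1 (e2 z))
  (s1E : forall z, s1 z = e1 z - p1 z) (s2E : forall z, s2 z = e2 z - p2 z).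
Hypotheses
  (dE : forall a, d (E a) = e1 (d a))
  (e2d : forall a, e2 (d a) = e1 (d a))
  (dP : forall a, d (P a) = p1 (d a) + p2 (d a) - 2 *: e1 (d a)).

Let lB (f : {linear W -> W}) x y : f (x - y) = f x - f y := linearB f x y.
Let lD (f : {linear W -> W}) x y : f (x + y) = f x + f y := linearD f x y.
Let lZ (f : {linear W -> W}) c x : f (c *: x) = c *: f x := linearZ_LR f c x.

(* The commutator of [P] and [E] lies in the centroid, on which both slots
   agree: apply [d] to [P (E a) - E (P a)]. *)
Let e2p2d a : e2 (p2 (d a)) = p2 (e1 (d a)) - p1 (e1 (d a)) + e1 (p1 (d a)).
Proof.
have: e1 (d (P a)) = e2 (d (P a)) by rewrite e2d.
rewrite !dP !(lB, lD, lZ) e1p2 e2p1 e2d e2e1 e2d => /eqP.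
rewrite (inj_eq (addIr _)) => /eqP h.
by rewrite addrC addrA h [X in X - _]addrC addrK.
Qed.

(** [p1 (l1 a (e1 z))] is expanded by [p1l1] directly, and again after [l1e1] has absorbed [e1] into
    [a]; the terms in [E (E a)] cancel. The rules down to [l2e1e1] all serve to absorb every [e1]
    into the index of [l1] or [l2]. *)
Let l1p1e1 a b : l1 a (p1 (e1 (d b))) =
  l1 (P (E a)) (d b) - l1 (E (P a)) (d b) + l1 (E a) (p1 (d b)).
Proof.
have := p1l1 a (e1 (d b)); rewrite !l1e1 p1l1 => /eqP.
by rewrite (inj_eq (addIr _)) => /eqP h; rewrite addrAC h addrAC subrr add0r.
Qed.

Let l1p2e1 a b : l1 a (p2 (e1 (d b))) = l1 (E a) (p2 (d b)).
Proof. by rewrite -e1p2 l1e1. Qed.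

(** On a coproduct [e1] agrees with [e2], and the latter shares its slot with [l2]. *)
Let l2e1 a b : l2 a (e1 (d b)) = l2 (E a) (d b).
Proof. by rewrite -e2d l2e2. Qed.

Let l2p1e1 a b : l2 a (p1 (e1 (d b))) = l2 (E a) (p1 (d b)).
Proof. by rewrite -e2d -e2p1 l2e2. Qed.

Let l2p2e1 a b : l2 a (p2 (e1 (d b))) =
  l2 (P (E a)) (d b) - l2 (E (P a)) (d b) + l2 (E a) (p2 (d b)).
Proof.
have := p2l2 a (e1 (d b)); rewrite !l2e1 p2l2 => /eqP.
by rewrite (inj_eq (addIr _)) => /eqP h; rewrite addrAC h addrAC subrr add0r.
Qed.

(** No hypothesis moves [e1] past [p1]. Relation [e2p2d] trades this word for one where [e2] stands
    outermost and is absorbed by [l2e2]; the claim is that relation solved for the word. *)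
Let l2e1p1 a b : l2 a (e1 (p1 (d b))) =
  l2 (E a) (p1 (d b)) - l2 (P (E a)) (d b) + l2 (E (P a)) (d b).
Proof.
have := congr1 (l2 a) (e2p2d b); rewrite l2e2 linearD linearB l2p1e1 l2p2e1 => h.
apply: scalar_ext => phi; have := congr1 phi (esym h).
by rewrite !(scalarE phi) => /eqP; rewrite -subr_eq0 => /eqP h0;
  apply/eqP; rewrite -subr_eq0 -h0; apply/eqP; ring.
Qed.

Let l2e1e1 a b : l2 a (e1 (e1 (d b))) = l2 (E (E a)) (d b).
Proof. by rewrite -e2d -e2e1 l2e2 l2e1. Qed.

Let l1dP x a : l1 x (d (P a)) = l1 x (p1 (d a)) + l1 x (p2 (d a)) - 2 *: l1 (E x) (d a).
Proof. by rewrite dP lB lD lZ l1e1. Qed.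

Let l2dP x a : l2 x (d (P a)) = l2 x (p1 (d a)) + l2 x (p2 (d a)) - 2 *: l2 (E x) (d a).
Proof. by rewrite dP lB lD lZ l2e1. Qed.

Let s1l1 x z : s1 (l1 x z) = - (l1 (P x) z + l1 x (p1 z)).
Proof. by rewrite s1E e1l1 p1l1 opprD addrCA subrr addr0. Qed.

Let s2l2 x z : s2 (l2 x z) = - (l2 (P x) z + l2 x (p2 z)).
Proof. by rewrite s2E e2l2 p2l2 opprD addrCA subrr addr0. Qed.

Let s2l1 x b : s2 (l1 x (d b)) = l1 (E x) (d b) - l1 x (p2 (d b)).
Proof. by rewrite s2E e2l1 p2l1 e2d l1e1. Qed.

Let p1dP b : p1 (d (P b)) = p1 (p1 (d b)) + p1 (p2 (d b)) - 2 *: p1 (e1 (d b)).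
Proof. by rewrite dP lB lD lZ. Qed.

Let p2dP b : p2 (d (P b)) = p1 (p2 (d b)) + p2 (p2 (d b)) - 2 *: p2 (e1 (d b)).
Proof. by rewrite dP lB lD lZ p2p1. Qed.

Let e1dP b : e1 (d (P b)) = e1 (p1 (d b)) + p2 (e1 (d b)) - 2 *: e1 (e1 (d b)).
Proof. by rewrite dP lB lD lZ e1p2. Qed.

Let s1l2dP a b : s1 (l2 a (d (P b))) =
  l2 (E a) (p1 (d b)) *+ 3 + l2 (E a) (p2 (d b)) - l2 (E (E a)) (d b) *+ 2
  - l2 a (p1 (p1 (d b))) - l2 a (p1 (p2 (d b))).
Proof.
rewrite s1E e1l2 p1l2 e1dP p1dP !(lB, lD, lZ) l2e1p1 l2p2e1 l2e1e1 l2p1e1.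
apply: scalar_ext => phi.
by rewrite !(scalarE phi); ring.
Qed.

Let s2l2dP a b : s2 (l2 a (d (P b))) =
  - l2 (P a) (p1 (d b)) - l2 (P a) (p2 (d b)) + l2 (P (E a)) (d b) *+ 2
  + l2 (E a) (p2 (d b)) *+ 2 - l2 a (p1 (p2 (d b))) - l2 a (p2 (p2 (d b))).
Proof.
rewrite s2l2 l2dP p2dP !(lB, lD, lZ) l2p2e1.
apply: scalar_ext => phi.
by rewrite !(scalarE phi); ring.
Qed.

Let l1p1s1 a b : l1 a (p1 (s1 (d b))) =
  l1 (P (E a)) (d b) - l1 (E (P a)) (d b) + l1 (E a) (p1 (d b)) - l1 a (p1 (p1 (d b))).
Proof. by rewrite s1E !lB l1p1e1. Qed.

Let l1p1s2 a b : l1 a (p1 (s2 (d b))) =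
  l1 (P (E a)) (d b) - l1 (E (P a)) (d b) + l1 (E a) (p1 (d b)) - l1 a (p1 (p2 (d b))).
Proof. by rewrite s2E !lB e2d l1p1e1. Qed.

Let l2p2s1 a b : l2 a (p2 (s1 (d b))) =
  l2 (P (E a)) (d b) - l2 (E (P a)) (d b) + l2 (E a) (p2 (d b)) - l2 a (p1 (p2 (d b))).
Proof. by rewrite s1E !lB p2p1 l2p2e1. Qed.

Let l2p2s2 a b : l2 a (p2 (s2 (d b))) =
  l2 (P (E a)) (d b) - l2 (E (P a)) (d b) + l2 (E a) (p2 (d b)) - l2 a (p2 (p2 (d b))).
Proof. by rewrite s2E !lB e2d l2p2e1. Qed.

Let l1s1 x b : l1 x (s1 (d b)) = l1 (E x) (d b) - l1 x (p1 (d b)).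
Proof. by rewrite s1E lB l1e1. Qed.

Let l1s2 x b : l1 x (s2 (d b)) = l1 (E x) (d b) - l1 x (p2 (d b)).
Proof. by rewrite s2E lB e2d l1e1. Qed.

Let l2s1 x b : l2 x (s1 (d b)) = l2 (E x) (d b) - l2 x (p1 (d b)).
Proof. by rewrite s1E lB l2e1. Qed.

Let l2s2 x b : l2 x (s2 (d b)) = l2 (E x) (d b) - l2 x (p2 (d b)).
Proof. by rewrite s2E lB l2e2. Qed.

(** The defect of the antisymmetry condition at [x] and [y]. *)
Let R x y := l1 y (d x) - l2 y (d x) - (l1 x (d y) - l2 x (d y)).

Let cob (u v : k) x := (v + 1) *: s1 x - (u + 1) *: s2 x.
Let ad1 (m : k) a (s : k) x := m *: l1 a (p1 x) - s *: l1 (P a) x.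
Let ad2 (m : k) a (s : k) x := m *: l2 a (p2 x) - s *: l2 (P a) x.

Let p1R x y : p1 (R x y) = 
 (l1 (P y) (d x) + l1 y (p1 (d x)) + l1 (E y) (d x)) - l2 y (p1 (d x))
  - (l1 (P x) (d y) + l1 x (p1 (d y)) + l1 (E x) (d y) - l2 x (p1 (d y))).
Proof. by rewrite /R !lB !p1l1 !p1l2. Qed.

Let p1p1R x y : p1 (p1 (R x y)) =
  l1 (P (P y)) (d x) + l1 (P y) (p1 (d x)) *+ 2 + l1 (E (P y)) (d x)
  + l1 y (p1 (p1 (d x))) + l1 (E y) (p1 (d x)) *+ 2
  + l1 (P (E y)) (d x) + l1 (E (E y)) (d x) - l2 y (p1 (p1 (d x)))
  - (l1 (P (P x)) (d y) + l1 (P x) (p1 (d y)) *+ 2 + l1 (E (P x)) (d y)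
  + l1 x (p1 (p1 (d y))) + l1 (E x) (p1 (d y)) *+ 2
  + l1 (P (E x)) (d y) + l1 (E (E x)) (d y) - l2 x (p1 (p1 (d y)))).
Proof.
rewrite p1R !(lB p1, lD p1) !p1l1 !p1l2.
apply: scalar_ext => phi.
by rewrite !(scalarE phi); ring.
Qed.

Let l1p1dP x b : l1 x (p1 (d (P b))) = l1 x (p1 (p1 (d b))) + l1 x (p1 (p2 (d b)))
  - 2 *: (l1 (P (E x)) (d b) - l1 (E (P x)) (d b) + l1 (E x) (p1 (d b))).
Proof. by rewrite p1dP lB lD lZ l1p1e1. Qed.

Let l2p1dP x b : l2 x (p1 (d (P b))) = l2 x (p1 (p1 (d b))) + l2 x (p1 (p2 (d b)))
  - 2 *: l2 (E x) (p1 (d b)).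
Proof. by rewrite p1dP lB lD lZ l2p1e1. Qed.

Let cobE u v (m n : k) x y z t :
  cob u v (m *: (x + y) - n *: (z + t)) =
  (v + 1) *: (m *: (s1 x + s1 y) - n *: (s1 z + s1 t))
  - (u + 1) *: (m *: (s2 x + s2 y) - n *: (s2 z + s2 t)).
Proof. by rewrite /cob !(lB s1, lZ s1, lD s1, lB s2, lZ s2, lD s2). Qed.

Let ad1E m a s u v z : ad1 m a s (cob u v z) =
  m *: ((v + 1) *: l1 a (p1 (s1 z)) - (u + 1) *: l1 a (p1 (s2 z)))
  - s *: ((v + 1) *: l1 (P a) (s1 z) - (u + 1) *: l1 (P a) (s2 z)).
Proof. by rewrite /ad1 /cob !(lB p1, lZ p1, lB (l1 _), lZ (l1 _)). Qed.

Let ad2E m a s u v z : ad2 m a s (cob u v z) =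
  m *: ((v + 1) *: l2 a (p2 (s1 z)) - (u + 1) *: l2 a (p2 (s2 z)))
  - s *: ((v + 1) *: l2 (P a) (s1 z) - (u + 1) *: l2 (P a) (s2 z)).
Proof. by rewrite /ad2 /cob !(lB p2, lZ p2, lB (l2 _), lZ (l2 _)). Qed.

(** The condition on [v] says [m + n - 1 = u + v + 2]: the degree of the bracket is the one seen by
    the component [(u, v)] of its cobracket. The shift [u - m + 1] is the degree that bracketing
    with degree [m] sends to [u]. *)
Lemma cocycle_identity (a b : A) (u v m n : k) :
  v = m + n - 3 - u ->
  (forall x y, l1 y (d x) - l2 y (d x) = l1 x (d y) - l2 x (d y)) ->
  cob u v (m *: (l2 a (d (P b)) + l1 (P b) (d a))
           - n *: (l2 b (d (P a)) + l1 (P a) (d b)))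
  = (ad1 m a (u - m + 1) (cob (u - m + 1) v (d b))
     + ad2 m a (v - m + 1) (cob u (v - m + 1) (d b)))
  - (ad1 n b (u - n + 1) (cob (u - n + 1) v (d a))
     + ad2 n b (v - n + 1) (cob u (v - n + 1) (d a))).
Proof.
move=> -> asi.
(* In the basis of all [l_i w (p1^r p2^s (d x))], with [w] a word in [P], [E]
   applied to [a] or [b], the two sides differ by a combination of the nine
   instances [r1], ..., [r9] of the relation [R]; its coefficients solve a
   linear system. *)
have R0 x y : R x y = 0 by rewrite /R asi subrr.
have p1R0 x y : p1 (R x y) = 0 by rewrite R0 linear0.
rewrite cobE !ad1E !ad2E.
rewrite 2!s1l1 2!s2l1 2!s1l2dP 2!s2l2dP 2!l1p1s1 2!l1p1s2 2!l2p2s1 2!l2p2s2.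
rewrite 2!l1s1 2!l1s2 2!l2s1 2!l2s2.
apply: scalar_ext => phi.
have addr_mulr_eq0 (c r x y : k) : r = 0 -> x = y + c * r -> x = y.
  by move=> ->; rewrite mulr0 addr0.
(* Each relation is brought to the same normal form as the goal, so that [ring] meets the same atoms
   on both sides. *)
have r1 : phi (R (P a) (P b)) = 0 by rewrite R0 linear0.
rewrite /R !l1dP !l2dP !(scalarE phi) in r1.
have r2 : phi (p1 (R (P a) b)) = 0 by rewrite p1R0 linear0.
rewrite p1R !l1p1dP !l2p1dP !l1dP !(scalarE phi) in r2.
have r3 : phi (R (P a) (E b)) = 0 by rewrite R0 linear0.
rewrite /R !l1dP !l2dP !dE l1e1 l2e1 !(scalarE phi) in r3.
have r4 : phi (p1 (R a (P b))) = 0 by rewrite p1R0 linear0.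
rewrite p1R !l1p1dP !l2p1dP !l1dP !(scalarE phi) in r4.
have r5 : phi (R a (E (P b))) = 0 by rewrite R0 linear0.
rewrite /R dE l1e1 l2e1 !l1dP !l2dP !(scalarE phi) in r5.
have r6 : phi (R a (P (E b))) = 0 by rewrite R0 linear0.
rewrite /R !l1dP !l2dP !dE l1p1e1 l1p2e1 l1e1 l2p1e1 l2p2e1 l2e1 !(scalarE phi) in r6.
have r7 : phi (p1 (R a (E b))) = 0 by rewrite p1R0 linear0.
rewrite p1R !dE !l1e1 l1p1e1 l2p1e1 !(scalarE phi) in r7.
have r8 : phi (R a (E (E b))) = 0 by rewrite R0 linear0.
rewrite /R !dE 2!l1e1 l2e1e1 !(scalarE phi) in r8.
have r9 : phi (p1 (p1 (R a b))) = 0 by rewrite p1R0 !linear0.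
rewrite p1p1R !(scalarE phi) in r9.
rewrite !(scalarE phi).
apply: (addr_mulr_eq0 ((u + 1) * (m + n - 2 - u)) _ _ _ r1).
apply: (addr_mulr_eq0 (n * (u + 2 - n)) _ _ _ r2).
apply: (addr_mulr_eq0 (- n * (u + 2 - n)) _ _ _ r3).
apply: (addr_mulr_eq0 (m * (u + 2 - m)) _ _ _ r4).
apply: (addr_mulr_eq0 (m * (m + n - 2 - u)) _ _ _ r5).
apply: (addr_mulr_eq0 (- (m * n)) _ _ _ r6).
apply: (addr_mulr_eq0 (3 * (m * n)) _ _ _ r7).
apply: (addr_mulr_eq0 (- 2 * (m * n)) _ _ _ r8).
apply: (addr_mulr_eq0 (- (m * n)) _ _ _ r9).
ring.
Qed.
End CocycleIdentity.

(** * Completed tensor products of maps *)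

Section CompletedMaps.
Variables (k : fieldType) (I J' : choiceType) (V : I -> vectType k) (W' : J' -> vectType k).
Notation idL := (@dsum_val k I V).
Implicit Types (f : dsum V -> cprod W') (x y : cprod (ftens V V)).

Lemma ctmap_term_id_l f x r p : p.1 != r.1 -> ctmap_term idL f x r p = 0.
Proof. by move=> pr; apply: tmap0l => v; apply: dinj_out. Qed.

Lemma ctmap_term_id_r f x r p : p.2 != r.2 -> ctmap_term f idL x r p = 0.
Proof. by move=> pr; apply: tmap0r => v; apply: dinj_out. Qed.

(** The identity slot forces the first index to be [r1] and the assumption forces the second to be
    [s], so the sum collapses to one term. *)
Lemma ctmap_id_l s f x r1 r2 :
  (forall t, t != s -> forall v, f (dinj V t v) r2 = 0) ->
  ctmap idL f x (r1, r2) = tmap id (fun v => f (dinj V s v) r2) (x (r1, s)).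
Proof.
move=> fs; rewrite /ctmap (fsum1 (t0 := (r1, s))) => [|[p1 p2] ps].
  by apply: eq_tmap => // v; apply: dinj_in.
have [pr|pr] := eqVneq p1 r1; last exact: ctmap_term_id_l.
by apply: tmap0r => v; apply: fs; apply: contraNneq ps => /= ->; rewrite pr.
Qed.

Lemma ctmap_id_r s f x r1 r2 :
  (forall t, t != s -> forall v, f (dinj V t v) r1 = 0) ->
  ctmap f idL x (r1, r2) = tmap (fun v => f (dinj V s v) r1) id (x (s, r2)).
Proof.
move=> fs; rewrite /ctmap (fsum1 (t0 := (s, r2))) => [|[p1 p2] ps].
  by apply: eq_tmap => // v; apply: dinj_in.
have [pr|pr] := eqVneq p2 r2; last exact: ctmap_term_id_r.
by apply: tmap0l => v; apply: fs; apply: contraNneq ps => /= ->; rewrite pr.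
Qed.

End CompletedMaps.
Arguments ctmap_id_l {k I J' V W'} s {f x r1 r2} _.
Arguments ctmap_id_r {k I J' V W'} s {f x r1 r2} _.

Section CtmapLinear.
Variables (k : fieldType) (I J I' J' : choiceType).
Variables (V : I -> vectType k) (W : J -> vectType k).
Variables (V' : I' -> vectType k) (W' : J' -> vectType k).
Implicit Types (f : dsum V -> cprod V') (g : dsum W -> cprod W').

Lemma ctmapP f g c x y : ctmap_summable f g x -> ctmap_summable f g y ->
  ctmap f g (c *: x + y) = c *: ctmap f g x + ctmap f g y.
Proof.
move=> sx sy; apply: cprodP => r; rewrite cprodDE cprodZE /ctmap -(fsumP c (sx r) (sy r)).
apply: eq_fsbigr => p _; exact: linearP.
Qed.

Lemma ctmapPl f f' g c x : ctmap_summable f g x -> ctmap_summable f' g x ->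
  ctmap (fun a => c *: f a + f' a) g x = c *: ctmap f g x + ctmap f' g x.
Proof.
move=> sx sy; apply: cprodP => r; rewrite cprodDE cprodZE /ctmap -(fsumP c (sx r) (sy r)).
apply: eq_fsbigr => p _; exact: tmapPl.
Qed.

Lemma ctmapPr f g g' c x : ctmap_summable f g x -> ctmap_summable f g' x ->
  ctmap f (fun a => c *: g a + g' a) x = c *: ctmap f g x + ctmap f g' x.
Proof.
move=> sx sy; apply: cprodP => r; rewrite cprodDE cprodZE /ctmap -(fsumP c (sx r) (sy r)).
apply: eq_fsbigr => p _; exact: tmapPr.
Qed.
End CtmapLinear.

(** * The cocycle identity on the tensor square *)

Section LoopCocycle.
Variables (k : fieldType) (A : vectType k) (mul : {bilinear A -> A -> A}).
Variables (delta : {linear A -> tensor A A}) (E P : {linear A -> A}).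
Hypothesis E_mul : forall a b, E (mul a b) = mul (E a) b.
Hypothesis mulC : commutative mul.
Hypothesis P_mul : forall a b, P (mul a b) = mul (P a) b + mul a (P b) + E (mul a b).
Hypothesis coC : forall a, tswap (delta a) = delta a.
Hypothesis coE : forall a, delta (E a) = tmap id E (delta a).
Hypothesis coP : forall a, delta (P a) =
  tmap P id (delta a) + tmap id P (delta a) - 2 *: tmap id E (delta a).
Hypothesis delta_mul : forall a b,
  delta (mul a b) = tmap id (mul a) (delta b) + tmap (mul b) id (delta a).
Hypothesis delta_asi : forall a b,
  tmap (mul b) id (delta a) - tmap id (mul b) (delta a)
  = tmap (mul a) id (delta b) - tmap id (mul a) (delta b).

Lemma loop_cobk_bk (a b : A) (u v m n : k) : v = m + n - 3 - u ->
  loop_cobk (E \- P) u v (delta (loop_bk mul P m a n b)) =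
  (tmap (loop_bk mul P m a (u - m + 1)) id
      (loop_cobk (E \- P) (u - m + 1) v (delta b))
   + tmap id (loop_bk mul P m a (v - m + 1))
      (loop_cobk (E \- P) u (v - m + 1) (delta b)))
  - (tmap (loop_bk mul P n b (u - n + 1)) id
      (loop_cobk (E \- P) (u - n + 1) v (delta a))
   + tmap id (loop_bk mul P n b (v - n + 1))
      (loop_cobk (E \- P) u (v - n + 1) (delta a))).
Proof.
move=> uv.
(* Commutativity turns the term [y P(a')] of [loop_bk] into multiplication by [P a'], the form
   expected by [cocycle_identity]. *)
have bk1 m' a' s x : tmap (loop_bk mul P m' a' s) id x =
    m' *: tmap (mul a') idfun (tmap P idfun x) - s *: tmap (mul (P a')) idfun x.
  rewrite (tmap_comp (mul a') idfun P idfun) -!tmapZl -tmapBl.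
  by apply: eq_tmap => // y; rewrite /loop_bk (mulC y).
have bk2 m' a' s x : tmap id (loop_bk mul P m' a' s) x =
    m' *: tmap idfun (mul a') (tmap idfun P x) - s *: tmap idfun (mul (P a')) x.
  rewrite (tmap_comp idfun (mul a') idfun P) -!tmapZr -tmapBr.
  by apply: eq_tmap => // y; rewrite /loop_bk (mulC y).
have -> : delta (loop_bk mul P m a n b) =
  m *: (tmap idfun (mul a) (delta (P b)) + tmap (mul (P b)) idfun (delta a))
  - n *: (tmap idfun (mul b) (delta (P a)) + tmap (mul (P a)) idfun (delta b)).
  by rewrite /loop_bk linearB 2!linearZ /= !delta_mul.
rewrite !bk1 !bk2.
have slots (f g : {linear A -> A}) x :
    tmap f idfun (tmap idfun g x) = tmap idfun g (tmap f idfun x).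
  by rewrite !tmap_comp; apply: eq_tmap.
have E_mulr a' b' : E (mul a' b') = mul a' (E b') by rewrite mulC E_mul mulC.
have El a' : tmap E idfun (delta a') = delta (E a').
  by rewrite coE -{1}coC -(tswap_tmap idfun E) -coE coC.
apply: (@cocycle_identity k A (tensor A A) delta E P (fun a => tmap (mul a) idfun)
   (fun a => tmap idfun (mul a)) (tmap P idfun) (tmap idfun P) (tmap E idfun) (tmap idfun E)
   (tmap (E \- P) idfun) (tmap idfun (E \- P))).
- move=> a' z /=; rewrite !tmap_comp -!tmapDl; apply: eq_tmap => // y /=.
  by rewrite P_mul E_mul.
- move=> a' z /=; rewrite !tmap_comp -!tmapDr; apply: eq_tmap => // y /=.
  by rewrite P_mul E_mul.
- by move=> a' z /=; rewrite slots.
- by move=> a' z /=; rewrite slots.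
- by move=> a' z /=; rewrite tmap_comp; apply: eq_tmap => // y /=; rewrite E_mul.
- by move=> a' z /=; rewrite tmap_comp; apply: eq_tmap => // y /=; rewrite E_mul.
- by move=> a' z /=; rewrite tmap_comp; apply: eq_tmap => // y /=; rewrite -E_mulr E_mul.
- by move=> a' z /=; rewrite tmap_comp; apply: eq_tmap => // y /=; rewrite -E_mulr E_mul.
- by move=> a' z /=; rewrite slots.
- by move=> a' z /=; rewrite slots.
- by move=> z /=; rewrite slots.
- by move=> z /=; rewrite slots.
- by move=> z /=; rewrite slots.
- by move=> z /=; rewrite slots.
- by move=> z /=; rewrite -tmapBl.
- by move=> z /=; rewrite -tmapBr.
- by move=> a' /=; rewrite El.
- by move=> a' /=; rewrite El coE.
- by move=> a' /=; rewrite coP El coE.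
- exact: uv.
- by move=> x y; exact: delta_asi.
Qed.
End LoopCocycle.

(** * Components of the loop operations *)

Section LoopFormulas.
Variables (k : fieldType) (A : vectType k).

Lemma monoE (a : A) (m u : int) : mono a m u = if m == u then a else 0.
Proof. by have [<-|mu] := eqVneq m u; rewrite /mono ?dinj_in ?dinj_out. Qed.

Lemma linear_tlift (U V : vectType k) (W W' : lmodType k) (h : {linear W -> W'})
    (f : U -> V -> W) x :
  h (tlift f x) = tlift (fun u v => h (f u v)) x.
Proof.
rewrite /tlift linear_sum; apply: eq_bigr => i _.
by rewrite linear_sum; apply: eq_bigr => j _; rewrite linearZ_LR.
Qed.

Lemma tlift_swap (U V U' V' : vectType k) (f : U -> U') (g : V -> V') x :
  tlift (fun u v => tens (g v) (f u)) x = tswap (tmap f g x).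
Proof. by rewrite linear_tlift; apply: eq_tlift => u v; apply/esym/tswapE. Qed.

Section Cobracket.
Variables (delta : {linear A -> tensor A A}) (D Q : A -> A) (q : k) (S : {linear A -> A}).
Hypothesis S_eq : forall a, S a = Q a + q *: D a.
Hypothesis coC : forall a, tswap (delta a) = delta a.

Lemma loop_cobracket_mono_at (a : A) (m u v : int) :
  loop_cobracket_mono delta D Q q a m (u, v) =
  if m == u + v + 2 then loop_cobk S u%:~R v%:~R (delta a) else 0.
Proof.
(* [h x y i] is the first half of the summand [i] at the component [(x, y)]. The exponent
   [- i - 2 = x] forces [i = - x - 2], hence [m = x + y + 2] and the coefficient [- (x + 1)]. The
   second half is the swap of [h v u i], alive only at [i = - v - 2]. *)
pose h (x y i : int) : tensor A A :=
  (i + 1)%:~R *: tmap (fun b => mono b (- i - 2) x) (fun b => mono (S b) (m + i) y) (delta a).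
have h0 x y i : i != - x - 2 -> h x y i = 0.
  move=> ix; rewrite /h tmap0l ?scaler0 // => b.
  rewrite monoE; case: eqVneq => // e; case/eqP: ix; lia.
have hE x y : h x y (- x - 2) =
    if m == x + y + 2 then - (x + 1)%:~R *: tmap id S (delta a) else 0.
  rewrite /h; have -> : - x - 2 + 1 = - (x + 1) :> int by lia.
  rewrite rmorphN; case: eqVneq => [mxy|mxy].
    congr (_ *: _); apply: eq_tmap => b; rewrite monoE ifT //; apply/eqP; lia.
  rewrite tmap0r ?scaler0 // => b.
  rewrite monoE; case: eqVneq => // e; case/eqP: mxy; lia.
have fin1 (F : int -> tensor A A) x :
    (forall i, i != x -> F i = 0) -> finite_set [set i | F i != 0]%classic.
  move=> F0; apply: (@sub_finite_set _ _ [set x]%classic _ (finite_set1 _)) => i /= Fi.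
  by apply/eqP; apply: contraNT Fi => /F0 ->.
have th0 i : i != - v - 2 -> tswap (h v u i) = 0 by move=> /h0 ->; rewrite linear0.
rewrite /loop_cobracket_mono /csum.
transitivity (\sum_(i \in [set: int]%classic) (- 1 *: tswap (h v u i) + h u v i)).
  apply: eq_fsbigr => i _; rewrite -[LHS]/(cproj (u, v) _) linear_tlift.
  have -> : tswap (h v u i) = (i + 1)%:~R *:
      tlift (fun b c => tens (mono (S c) (m + i) u) (mono b (- i - 2) v)) (delta a).
    by rewrite /h tlift_swap linearZ_LR.
  rewrite /h scalerA mulrC -scalerA -scalerDr -tlift_funP.
  rewrite -[RHS]/(GRing.scale _ _) linear_tlift; apply: eq_tlift => b c.
  by rewrite raddfMz -scaler_int S_eq /=; congr (_ *: _); rewrite scaleN1r [RHS]addrC.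
rewrite fsumP; [|exact: fin1 th0|exact: fin1 (h0 u v)].
rewrite (fsum1 th0) (fsum1 (h0 u v)) !hE [v + u]addrC; case: eqP => _; last first.
  by rewrite linear0 scaler0 addr0.
have ts : tswap (tmap id S (delta a)) = tmap S id (delta a).
  by rewrite (tswap_tmap idfun S) coC.
by rewrite /loop_cobk linearZ_LR /= ts scalerA mulN1r opprK scaleNr !rmorphD.
Qed.

Lemma loop_cobracket_at (x : dsum (loop A)) (u v : int) :
  loop_cobracket delta D Q q x (u, v) =
  loop_cobk S u%:~R v%:~R (delta (x (u + v + 2))).
Proof.
rewrite /loop_cobracket -[LHS]/(cproj (u, v) _).
have mono_at m a : cproj (u, v) (loop_cobracket_mono delta D Q q a m) =
  if m == u + v + 2 then loop_cobk S u%:~R v%:~R (delta a) else 0.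
  exact: loop_cobracket_mono_at.
rewrite linear_dlift => [|m].
  rewrite (fsum1 (t0 := u + v + 2)) => [|m /negPf mx].
    by apply: etrans (mono_at _ _) _; rewrite eqxx.
  by apply: etrans (mono_at _ _) _; rewrite mx.
apply: cprodP => -[u' v']; rewrite loop_cobracket_mono_at !linear0.
by case: ifP.
Qed.
End Cobracket.

Section Bracket.
Variables (mul : {bilinear A -> A -> A}) (D Q P : {linear A -> A}) (q : k).
Hypothesis P_eq : forall a b, mul a (D b + q *: Q b) = mul a (P b).

Lemma loop_bracket_monoE a m b n :
  loop_bracket_mono mul D Q q a m b n =
  mono (loop_bk mul P m%:~R a n%:~R b) (m + n - 1).
Proof.
rewrite /loop_bracket_mono /loop_bk !P_eq /mono linearB.
by rewrite !(linearZ_LR (dinj (loop A) _)) -!scaler_int.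
Qed.

Lemma loop_bracket_mono_bilinear m n :
  is_bilinear (fun a b => loop_bracket_mono mul D Q q a m b n).
Proof.
split=> [b c x y|a c x y]; rewrite !loop_bracket_monoE /mono -linearP.
  congr dinj; apply: scalar_ext => phi; rewrite /loop_bk linearPl !linearP /=.
  by rewrite !(scalarE phi); ring.
congr dinj; apply: scalar_ext => phi; rewrite /loop_bk linearPl !linearP /=.
by rewrite !(scalarE phi); ring.
Qed.

Lemma loop_bracket_monos a m b n :
  loop_bracket mul D Q q (mono a m) (mono b n) =
  mono (loop_bk mul P m%:~R a n%:~R b) (m + n - 1).
Proof.
rewrite -loop_bracket_monoE loop_bracketE //; try exact: linearP.
by split=> ????; rewrite ?linearPl ?linearPr.
Qed.

Lemma loop_bracket_bilinear : is_bilinear (loop_bracket mul D Q q).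
Proof.
have bil := loop_bracket_mono_bilinear.
have lin_r m a : linear (dlift (fun n b => loop_bracket_mono mul D Q q a m b n)).
  by apply: dlift_linear => n; apply: (bil m n).2.
have lin_l m y : linear (fun a => dlift (fun n b => loop_bracket_mono mul D Q q a m b n) y).
  move=> c a a'; rewrite -dlift_funP => [|n|n].
  - by apply: eq_dlift => n b; apply: (bil m n).1.
  - exact: linear_at0 ((bil m n).2 a).
  - exact: linear_at0 ((bil m n).2 a').
split=> [y|x c y y']; first by apply: dlift_linear => m; apply: lin_l.
rewrite /loop_bracket -dlift_funP => [|m|m].
- by apply: eq_dlift => m a; apply: lin_r.
- exact: linear_at0 (lin_l m y).
- exact: linear_at0 (lin_l m y').
Qed.
End Bracket.
End LoopFormulas.

(** * The loop Lie bialgebra *)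

Section LoopBialgebra.
Variables (k : fieldType) (A : vectType k) (mul : {bilinear A -> A -> A}).
Variables (delta : {linear A -> tensor A A}) (E P : {linear A -> A}).
Hypothesis two_neq0 : 2 != 0 :> k.
Hypotheses (mulA : associative mul) (mulC : commutative mul).
Hypothesis E_mul : forall a b, E (mul a b) = mul (E a) b.
Hypothesis P_mul : forall a b, P (mul a b) = mul (P a) b + mul a (P b) + E (mul a b).
Hypothesis coA : forall a, tassoc (tmap delta id (delta a)) = tmap id delta (delta a).
Hypothesis coC : forall a, tswap (delta a) = delta a.
Hypothesis coE : forall a, delta (E a) = tmap id E (delta a).
Hypothesis coP : forall a, delta (P a) =
  tmap P id (delta a) + tmap id P (delta a) - 2 *: tmap id E (delta a).
Hypothesis delta_mul : forall a b,
  delta (mul a b) = tmap id (mul a) (delta b) + tmap (mul b) id (delta a).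
Hypothesis delta_asi : forall a b,
  tmap (mul b) id (delta a) - tmap id (mul b) (delta a)
  = tmap (mul a) id (delta b) - tmap id (mul a) (delta b).

Notation L := (dsum (loop A)).
Notation idL := (@dsum_val k int (loop A)).
Notation S := (E \- P).
(** The operations are known only by their values on monomials and by their components, so the
    axioms are proved once for both parts of the theorem. *)
Variables (br : L -> L -> L) (co : L -> cprod (ftens (loop A) (loop A))).
Hypothesis br_bilinear : is_bilinear br.
Hypothesis br_mono : forall a m b n,
  br (mono a m) (mono b n) = mono (loop_bk mul P m%:~R a n%:~R b) (m + n - 1).
Hypothesis co_at : forall (x : L) (u v : int),
  co x (u, v) = loop_cobk S u%:~R v%:~R (delta (x (u + v + 2))).

Let brPl c x y z : br (c *: x + y) z = c *: br x z + br y z.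
Proof. exact: br_bilinear.1. Qed.

Let brPr c x y z : br z (c *: x + y) = c *: br z x + br z y.
Proof. exact: br_bilinear.2. Qed.

Let br_anti x y : br x y + br y x = 0.
Proof.
move: x; apply: dsum_lin0 => [c x x'|m a]; first by rewrite brPl brPr addrACA scalerDr.
move: y; apply: dsum_lin0 => [c x x'|n b]; first by rewrite brPl brPr addrACA scalerDr.
rewrite -[dinj _ m a]/(mono a m) -[dinj _ n b]/(mono b n) !br_mono [n + m]addrC.
have -> : loop_bk mul P n%:~R b m%:~R a = - loop_bk mul P m%:~R a n%:~R b.
  by rewrite /loop_bk opprB.
by rewrite /mono -linearD subrr linear0.
Qed.

Lemma loop_lie_algebra : is_lie_algebra br.
Proof.
split=> [//|x|x y z].
  (* Antisymmetry only gives that twice the bracket of [x] with itself is 0; this is where 2 must be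
     invertible. *)
  have := br_anti x x; rewrite -mulr2n -scaler_nat => /eqP.
  by rewrite scaler_eq0 (negPf two_neq0) => /eqP.
(* The Jacobi sum is linear in each variable, so monomials suffice; there its three terms share one
   degree. *)
pose J x y z := br x (br y z) + br y (br z x) + br z (br x y).
have split3 c (a1 a2 a3 b1 b2 b3 : L) : c *: a1 + b1 + (c *: a2 + b2) + (c *: a3 + b3) =
    c *: (a1 + a2 + a3) + (b1 + b2 + b3).
  by rewrite !scalerDr [RHS]addrACA; congr (_ + _); rewrite addrACA.
rewrite -[LHS]/(J x y z); move: x; apply: dsum_lin0 => [c x x'|m a].
  by rewrite /J !(brPl, brPr) split3.
move: y; apply: (dsum_lin0 (h := J (dinj _ m a) ^~ z)) => [c y y'|n b].
  by rewrite /J !(brPl, brPr) split3.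
move: z; apply: (dsum_lin0 (h := J (dinj _ m a) (dinj _ n b))) => [c z z'|p d].
  by rewrite /J !(brPl, brPr) split3.
rewrite /J -[dinj _ m a]/(mono a m) -[dinj _ n b]/(mono b n) -[dinj _ p d]/(mono d p).
rewrite !br_mono.
have -> : n + (p + m - 1) - 1 = m + (n + p - 1) - 1 :> int by lia.
have -> : p + (m + n - 1) - 1 = m + (n + p - 1) - 1 :> int by lia.
rewrite /mono -!linearD !(rmorphD, rmorphN) /=.
by rewrite (loop_bk_jacobi mulA mulC E_mul P_mul) linear0.
Qed.

(** With [coE_l] putting every [E] in the second slot, both sides are three times the [E] term minus
    [P] on each slot. *)
Let coS a : delta (S a) =
  tmap S id (delta a) + tmap id S (delta a) + tmap id E (delta a).
Proof.
have El : tmap E id (delta a) = tmap id E (delta a) := coE_l coC coE a.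
rewrite /= linearB coE coP tmapBl tmapBr El scaler_nat.
apply: scalar_ext => phi; rewrite !(scalarE phi); ring.
Qed.

Let co_linear : linear co.
Proof.
move=> c x y; apply: cprodP => -[u v]; rewrite cprodDE cprodZE !co_at.
by rewrite dsumPE (linearP delta) (loop_cobk_linear _ _ _).
Qed.

Let co_antisym x : co x = - cswap (co x).
Proof.
apply: cprodP => -[u v]; rewrite -[RHS]/(- tswap (co x (v, u))) !co_at [v + u]addrC.
by rewrite (tswap_cobk _ coC) opprK.
Qed.

Let co_at0 (x : L) u v : x (u + v + 2) = 0 -> co x (u, v) = 0.
Proof. by move=> x0; rewrite co_at x0 linear0 linear0. Qed.

(** A contributing index [(u, v)] has [v = r2] and [u + v + 2] in the finite support of [x]. The map
    [f] is arbitrary, so this covers both [co] and [ad br x]. *)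
Lemma summable_id_r (J : choiceType) (V' : J -> vectType k) (f : L -> cprod V') x :
  ctmap_summable f idL (co x).
Proof.
move=> [r1 r2]; have finx := finite_dsum x.
apply: sub_finite_set (finite_image (fun s => (s - r2 - 2, r2)) finx).
move=> [u v] /= t0; have [vr|vr] := eqVneq v r2; last first.
  by move: t0; rewrite ctmap_term_id_r ?eqxx.
exists (u + v + 2); last by congr (_, _); rewrite // -vr; lia.
apply: contraNneq t0 => /co_at0 x0.
by rewrite /ctmap_term x0 linear0.
Qed.

Lemma summable_id_l (J : choiceType) (V' : J -> vectType k) (f : L -> cprod V') x :
  ctmap_summable idL f (co x).
Proof.
move=> [r1 r2]; have finx := finite_dsum x.
apply: sub_finite_set (finite_image (fun s => (r1, s - r1 - 2)) finx).
move=> [u v] /= t0; have [ur|ur] := eqVneq u r1; last first.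
  by move: t0; rewrite ctmap_term_id_l ?eqxx.
exists (u + v + 2); last by congr (_, _); rewrite // -ur; lia.
apply: contraNneq t0 => /co_at0 x0.
by rewrite /ctmap_term x0 linear0.
Qed.

Let co_mono t (b : A) (u v : int) :
  co (mono b t) (u, v) = if t == u + v + 2 then loop_cobk S u%:~R v%:~R (delta b) else 0.
Proof. by rewrite co_at monoE; case: ifP => // _; rewrite linear0 linear0. Qed.

(** A component [(v, w)] of the inner cobracket comes only from degree [v + w + 2], which is thus
    the second outer degree; the source degree is [u + (v + w + 2) + 2]. *)
Lemma ctmap_co_r (x : L) (u v w : int) : ctmap idL co (co x) (u, (v, w)) =
  tmap id (loop_cobk S v%:~R w%:~R \o delta)
    (loop_cobk S u%:~R (v%:~R + w%:~R + 2) (delta (x (u + v + w + 4)))).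
Proof.
rewrite (ctmap_id_l (v + w + 2)) => [|t /negPf ts b].
  rewrite co_at !rmorphD /=; have -> : u + (v + w + 2) + 2 = u + v + w + 4 :> int by lia.
  by apply: eq_tmap => // b; rewrite -/(mono b _) co_mono eqxx.
by rewrite -/(mono b _) co_mono ts.
Qed.

Lemma ctmap_co_l (x : L) (u v w : int) : ctmap co idL (co x) ((u, v), w) =
  tmap (loop_cobk S u%:~R v%:~R \o delta) id
    (loop_cobk S (u%:~R + v%:~R + 2) w%:~R (delta (x (u + v + w + 4)))).
Proof.
rewrite (ctmap_id_r (u + v + 2)) => [|t /negPf ts b].
  rewrite co_at !rmorphD /=; have -> : u + v + 2 + w + 2 = u + v + w + 4 :> int by lia.
  by apply: eq_tmap => // b; rewrite -/(mono b _) co_mono eqxx.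
by rewrite -/(mono b _) co_mono ts.
Qed.

Lemma loop_lie_coalgebra : is_completed_lie_coalgebra co.
Proof.
split=> [||x|x|x]; [exact: co_linear|exact: co_antisym|exact: summable_id_l
  |exact: summable_id_r|].
apply: cprodP => -[u [v w]].
rewrite -[LHS]/(ctmap idL co (co x) (u, (v, w))
                - tswap12 (ctmap idL co (co x) (v, (u, w)))).
rewrite -[RHS]/(tassoc (ctmap co idL (co x) ((u, v), w))).
rewrite !ctmap_co_r ctmap_co_l [v + u]addrC.
exact: (loop_cobk_jacobi coA coC coE coS).
Qed.

(** The adjoint action of [x] on the cobracket of [y]. *)
Let F x y := ctmap (ad br x) idL (co y) + ctmap idL (ad br x) (co y).

Let FPl c x x' y : F (c *: x + x') y = c *: F x y + F x' y.
Proof.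
have adP : ad br (c *: x + x') = fun b => c *: ad br x b + ad br x' b.
  by apply: functional_extensionality_dep => b; rewrite /ad brPl linearP.
rewrite /F adP (ctmapPl c (summable_id_r (ad br x) y) (summable_id_r (ad br x') y)).
rewrite (ctmapPr c (summable_id_l (ad br x) y) (summable_id_l (ad br x') y)).
by rewrite scalerDr addrACA.
Qed.

Let FPr c x y y' : F x (c *: y + y') = c *: F x y + F x y'.
Proof.
rewrite /F co_linear (ctmapP c (summable_id_r (ad br x) y) (summable_id_r (ad br x) y')).
rewrite (ctmapP c (summable_id_l (ad br x) y) (summable_id_l (ad br x) y')).
by rewrite scalerDr addrACA.
Qed.

Let ad_mono a (m : int) b (t u : int) : ad br (mono a m) (dinj (loop A) t b) u =
  if t == u - m + 1 then loop_bk mul P m%:~R a t%:~R b else 0.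
Proof.
rewrite /ad -/(mono b t) br_mono dsum_valE monoE; congr (if _ then _ else _).
by apply/eqP/eqP; lia.
Qed.

Let F_mono a (m : int) (y : L) (u v : int) : F (mono a m) y (u, v) =
  tmap (loop_bk mul P m%:~R a (u - m + 1)%:~R) id
    (loop_cobk S (u - m + 1)%:~R v%:~R (delta (y (u + v - m + 3))))
  + tmap id (loop_bk mul P m%:~R a (v - m + 1)%:~R)
    (loop_cobk S u%:~R (v - m + 1)%:~R (delta (y (u + v - m + 3)))).
Proof.
rewrite /F cprodDE (ctmap_id_r (u - m + 1)) => [|t /negPf ts b]; last first.
  by rewrite ad_mono ts.
rewrite (ctmap_id_l (v - m + 1)) => [|t /negPf ts b]; last first.
  by rewrite ad_mono ts.
rewrite !co_at.
have -> : u - m + 1 + v + 2 = u + v - m + 3 :> int by lia.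
have -> : u + (v - m + 1) + 2 = u + v - m + 3 :> int by lia.
by congr (_ + _); apply: eq_tmap => // b; rewrite ad_mono eqxx.
Qed.

Lemma loop_cocycle x y : co (br x y) = F x y - F y x.
Proof.
(* The defect is linear in [x] and in [y], so it is enough that it vanish on monomials. *)
pose G x y := co (br x y) - (F x y - F y x).
suff G0 : G x y = 0 by apply/eqP; rewrite -subr_eq0; apply/eqP.
have lin3 c (a1 a2 a3 b1 b2 b3 : cprod (ftens (loop A) (loop A))) :
    c *: a1 + b1 - (c *: a2 + b2 - (c *: a3 + b3)) =
    c *: (a1 - (a2 - a3)) + (b1 - (b2 - b3)).
  rewrite !scalerBr [RHS]addrACA -opprD; congr (_ - _).
  by rewrite opprD addrACA.
move: x; apply: (dsum_lin0 (h := G ^~ y)) => [c x x'|m a].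
  by rewrite /G brPl co_linear FPl FPr lin3.
move: y; apply: (dsum_lin0 (h := G (dinj _ m a))) => [c y y'|n b].
  by rewrite /G brPr co_linear FPl FPr lin3.
rewrite /G -[dinj _ m a]/(mono a m) -[dinj _ n b]/(mono b n).
apply: cprodP => -[u v]; apply/eqP; rewrite subr_eq0; apply/eqP.
rewrite -[RHS]/(F (mono a m) (mono b n) (u, v) - F (mono b n) (mono a m) (u, v)).
rewrite !F_mono br_mono co_mono !monoE.
have -> : (n == u + v - m + 3) = (m + n - 1 == u + v + 2) by apply/eqP/eqP; lia.
have -> : (m == u + v - n + 3) = (m + n - 1 == u + v + 2) by apply/eqP/eqP; lia.
(* All terms depend on the single condition [m + n - 1 = u + v + 2]; off that degree each of them is
   0. *)
case: eqP => [e|_]; last by rewrite !linear0 addr0 subrr.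
rewrite !(rmorphD, rmorphN, rmorph1) /=.
apply: (loop_cobk_bk E_mul mulC P_mul coC coE coP delta_mul delta_asi).
have -> : v = m + n - 3 - u :> int by lia.
by rewrite !(rmorphD, rmorphN).
Qed.

Lemma loop_lie_bialgebra : is_completed_lie_bialgebra br co.
Proof.
split=> [||x y|x y|x y].
- exact: loop_lie_algebra.
- exact: loop_lie_coalgebra.
- exact: summable_id_r.
- exact: summable_id_l.
- exact: loop_cocycle.
Qed.
End LoopBialgebra.

(** * From differential ASI bialgebras to the operators [E] and [P] *)

Section DifferentialASI.
Variables (k : fieldType) (A : vectType k) (mul : {bilinear A -> A -> A}).
Variables (delta : {linear A -> tensor A A}) (D Q : {linear A -> A}).
Hypothesis two_neq0 : 2 != 0 :> k.
Hypotheses (mulA : associative mul) (mulC : commutative mul).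
Hypothesis D_mul : forall a b, D (mul a b) = mul (D a) b + mul a (D b).
Hypothesis Q_mul : forall a b, Q (mul a b) = mul (Q a) b - mul a (D b).
Hypothesis coA : forall a, tassoc (tmap delta id (delta a)) = tmap id delta (delta a).
Hypothesis coC : forall a, tswap (delta a) = delta a.
Hypothesis coQ : forall a, delta (Q a) = tmap id Q (delta a) + tmap Q id (delta a).
Hypothesis coD : forall a, delta (D a) = tmap D id (delta a) - tmap id Q (delta a).
Hypothesis delta_mul : forall a b,
  delta (mul a b) = tmap id (mul a) (delta b) + tmap (mul b) id (delta a).
Hypothesis delta_asi : forall a b,
  tmap (mul b) id (delta a) - tmap id (mul b) (delta a)
  = tmap (mul a) id (delta b) - tmap id (mul a) (delta b).

(** The comparisons with [P] and [E - P] are required only inside products and coproducts, because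
    in case (b) [Q] agrees with [- D] only there. *)
Lemma loop_lie_bialgebra_of (E P : {linear A -> A}) (q : k) :
  (forall a b, E (mul a b) = mul (E a) b) ->
  (forall a b, P (mul a b) = mul (P a) b + mul a (P b) + E (mul a b)) ->
  (forall a, delta (E a) = tmap id E (delta a)) ->
  (forall a, delta (P a) =
    tmap P id (delta a) + tmap id P (delta a) - 2 *: tmap id E (delta a)) ->
  (forall a b, mul a (D b + q *: Q b) = mul a (P b)) ->
  (forall a, tmap id (fun b => Q b + q *: D b) (delta a) = tmap id (E \- P) (delta a)) ->
  is_completed_lie_bialgebra (loop_bracket mul D Q q) (loop_cobracket delta D Q q).
Proof.
move=> E_mul P_mul coE coP P_eq S_eq.
pose S : {linear A -> A} := Q \+ q \*: D.
have S_eq_l a : tmap S id (delta a) = tmap (E \- P) id (delta a).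
  rewrite -{1}coC -(tswap_tmap idfun S) S_eq (tswap_tmap idfun (E \- P)).
  by rewrite coC.
apply: (loop_lie_bialgebra two_neq0 mulA mulC E_mul P_mul coA coC coE coP delta_mul delta_asi).
- exact: loop_bracket_bilinear P_eq.
- exact: loop_bracket_monos P_eq.
- move=> x u v; rewrite (loop_cobracket_at (S := S)) //.
  by rewrite /loop_cobk S_eq_l; congr (_ - _ *: _); apply: S_eq.
Qed.

(** For [P = D + qQ] and [S = Q + qD], the map [E] has to be [P + S = (1 + q)(D + Q)]. The rule for
    [P (ab)] then fails by [(1 + 2q)(D + Q)(a) b], which vanishes at [q = -1/2]. *)
Lemma loop_lie_bialgebra_half (q : k) : q = - 2^-1 ->
  is_completed_lie_bialgebra (loop_bracket mul D Q q) (loop_cobracket delta D Q q).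
Proof.
move=> ->; pose E : {linear A -> A} := 2^-1 \*: (Q \+ D).
pose P : {linear A -> A} := D \- 2^-1 \*: Q.
(* Expanding [Q(ab)] and [Q(ba)] shows that [D + Q] can be moved from one factor of a product to the
   other. *)
have mulQ a b : mul a (Q b) = mul (Q a) b + mul (D a) b - mul a (D b).
  have := Q_mul b a; rewrite mulC Q_mul (mulC (Q b)) (mulC b) => /eqP.
  by rewrite eq_sym subr_eq addrAC => /eqP.
have tmap_r (f g : {linear A -> A}) a :
    tmap id (2^-1 \*: (f \+ g)) (delta a)
    = 2^-1 *: (tmap id f (delta a) + tmap id g (delta a)).
  by rewrite tmapZr tmapDr.
have coE a : delta (E a) = tmap id E (delta a).
  have -> : tmap id E (delta a) = tswap (tmap E id (delta a)).
    by rewrite (tswap_tmap E idfun) coC.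
  rewrite -coC; congr tswap.
  (* In [coQ] plus [coD] the terms with [Q] on the second slot cancel, leaving [D + Q] on the first;
     the swap above put [E] there. *)
  rewrite tmapZl tmapDl /= linearZ_LR linearD coQ coD.
  by rewrite [tmap id Q _ + _]addrC addrACA subrr addr0.
apply: (@loop_lie_bialgebra_of E P) => [a b|a b|a|a|a b|a] /=.
- rewrite Q_mul D_mul linearZl_LR linearDl.
  by apply: scalar_ext => phi; rewrite !(scalarE phi); ring.
- rewrite Q_mul D_mul linearBl linearBr linearZl_LR linearZr_LR mulQ.
  by apply: scalar_ext => phi; rewrite !(scalarE phi); field.
- exact: coE.
- rewrite linearB linearZ_LR coD coQ tmap_r tmapBl tmapBr tmapZr tmapZl.
  by apply: scalar_ext => phi; rewrite !(scalarE phi); field.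
- by rewrite scaleNr.
- rewrite tmapBr tmap_r tmapDr tmapBr tmapZr tmapZr.
  by apply: scalar_ext => phi; rewrite !(scalarE phi); field.
Qed.

(** Under the two assumptions [coD] becomes the co-Leibniz rule for [D], so any multiple of [D]
    satisfies the axioms for [P] with [E = 0]. *)
Lemma loop_lie_bialgebra_opp (q : k) :
  (forall a b, mul a (Q b) = - mul a (D b)) ->
  (forall a, tmap id Q (delta a) = - tmap id D (delta a)) ->
  is_completed_lie_bialgebra (loop_bracket mul D Q q) (loop_cobracket delta D Q q).
Proof.
move=> QD dQD; pose P : {linear A -> A} := (1 - q) \*: D.
have tmap0 a : tmap id (\0 : A -> A) (delta a) = 0 by apply: tmap0r.
apply: (@loop_lie_bialgebra_of \0 P) => [a b|a b|a|a|a b|a] /=.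
- by rewrite linear0l.
- by rewrite D_mul linearZl_LR linearZr_LR addr0 scalerDr.
- by rewrite linear0 tmap0.
- by rewrite linearZ_LR coD dQD opprK tmapZl tmapZr tmap0 scaler0 subr0 scalerDr.
- by rewrite linearDr !linearZr_LR /= QD scalerN scalerBl scale1r.
- rewrite tmapDr tmapZr tmapBr tmap0 tmapZr dQD sub0r scalerBl scale1r opprB addrC.
  by [].
Qed.
End DifferentialASI.

Theorem theorem2p28 (k : fieldType) (k_char0 : [pchar k] =i pred0)
    (A : vectType k) (mul : A -> A -> A) (delta : A -> tensor A A)
    (D Q : A -> A) (HA : is_cc_diff_ASI_bialgebra mul delta D Q) :
  (let q : k := - 2%:R^-1 in
   is_completed_lie_bialgebra (loop_bracket mul D Q q)
     (loop_cobracket delta D Q q))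
  /\
  ((forall a b : A, mul a (Q b) = - mul a (D b)) ->
   (forall a : A, tmap id Q (delta a) = - tmap id D (delta a)) ->
   forall q : k,
     is_completed_lie_bialgebra (loop_bracket mul D Q q)
       (loop_cobracket delta D Q q)).
Proof.
have two_neq0 : 2 != 0 :> k.
  by apply/negP => two0; have := k_char0 2%N; rewrite !inE two0.
case: HA => -[[mul_bil mulA] [delta_lin coA] asi_mul asi_antisym].
case=> _ mulC D_lin Q_lin D_mul Q_mul [_ coC _ _ coQ coD].
pose mul' : {bilinear A -> A -> A} :=
  HB.pack mul (bilinear_isBilinear.Build _ _ _ _ _ _ mul mul_bil).
pose delta' : {linear A -> tensor A A} :=
  HB.pack delta (GRing.isLinear.Build _ _ _ _ delta delta_lin).
pose D' : {linear A -> A} := HB.pack D (GRing.isLinear.Build _ _ _ _ D D_lin).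
pose Q' : {linear A -> A} := HB.pack Q (GRing.isLinear.Build _ _ _ _ Q Q_lin).
have swap_mul a b : tswap (tmap (mul b) id (delta a)) = tmap id (mul b) (delta a).
  by rewrite (tswap_tmap (mul' b) idfun) -coC.
have mul_r b x : tmap id (mul^~ b) x = tmap id (mul b) x.
  by apply: eq_tmap => // y; rewrite mulC.
have delta_mul a b :
    delta (mul a b) = tmap id (mul a) (delta b) + tmap (mul b) id (delta a).
  by rewrite asi_mul; congr (_ + _); apply: eq_tmap => // y; rewrite mulC.
(* Left and right multiplications agree, and by cocommutativity the swap exchanges the two terms of
   the second difference, hence changes its sign. *)
have delta_asi a b : tmap (mul b) id (delta a) - tmap id (mul b) (delta a)
    = tmap (mul a) id (delta b) - tmap id (mul a) (delta b).
  have swap_mul_r : tswap (tmap id (mul a) (delta b)) = tmap (mul a) id (delta b).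
    by rewrite (tswap_tmap idfun (mul' a)) -coC.
  have := asi_antisym a b; rewrite !mul_r linearB /= swap_mul swap_mul_r => /eqP.
  by rewrite addr_eq0 opprB => /eqP.
have coC' a : tswap (delta a) = delta a by rewrite -coC.
split=> [q|QD dQD q].
- apply: (@loop_lie_bialgebra_half k A mul' delta' D' Q') => //.
- apply: (@loop_lie_bialgebra_opp k A mul' delta' D' Q') => //.
Qed.
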